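(* Let $\lambda>0$, let $w=p/q\in(0,1)$ with $p,q$ relatively prime positive integers, and let $k\ge 2$ be an integer. Let $\Pi$ be a homogeneous Poisson point process of intensity $\lambda$ on $(0,1]$, and let $\alpha$, $\alpha_n$, $\nu(\Pi)$, $\tilde\nu(\Pi)$ be as defined in the context. Then, as $n\to\infty$ along $n=mq$ $(m=1,2,\dots)$, $$\lim_{n\to\infty} n(\alpha-\alpha_n)=\frac{\lambda}{2}\,\mathbb{E}\left[\nu(\Pi)+\tilde\nu(\Pi)\right].$$
   Context: $|\cdot|$ denotes the number of points of a (multi)set, counted with multiplicity. The continuous scan statistic is $S_w=S_w(\Pi):=\max_{0\le t\le 1-w}|\Pi\cap(t,t+w]|$, and $\alpha:=\mathbb{P}(S_w\ge k)$. For $n=mq$ (so that $nw$ is an integer), let $I^n_i:=\mathbf{1}\{\Pi\cap((i-1)/n,i/n]\neq\emptyset\}$, $i=1,\dots,n$; these are i.i.d. with $\mathbb{P}(I^n_i=0)=e^{-\lambda/n}$. Put $S^{(n)}_{w,I}:=\max_{i=1,\dots,n-nw+1}\sum_{r=i}^{i+nw-1}I^n_r$ and $\alpha_n:=\mathbb{P}(S^{(n)}_{w,I}\ge k)$. Let $M:=|\Pi|$ (Poisson with mean $\lambda$) and write $\Pi=\{Q_1,\dots,Q_M\}$. Almost surely $0<Q_1<\cdots<Q_M<1$, $w\notin\Pi$, $1-w\notin\Pi$, and $Q_j-Q_i\ne w$ for all $1\le i<j\le M$; the following functionals are defined on this almost sure event: $$\nu(\Pi):=\sum_{\{\ell:\,Q_\ell<1-w\}}\mathbf{1}\Big\{S_w<k,\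 |\Pi\cap(Q_\ell,Q_\ell+w]|=k-2,\ |\Pi\cap(t,t+w]|\le k-2\text{ for all }t\text{ with }Q_\ell\le t\le Q_\ell+w\Big\},$$ $$\tilde\nu(\Pi):=\sum_{\ell=1}^M\mathbf{1}\Big\{S_w<k,\ \max_{0\le t\le 1-w}|(\Pi\cup\{Q_\ell\})\cap(t,t+w]|=k\Big\},$$ where $\Pi\cup\{Q_\ell\}$ is interpreted as a multiset in which $Q_\ell$ has multiplicity $2$. *)

(* Defs.v *)
From HB Require Import structures.
From mathcomp Require Import all_boot all_order all_algebra.
From mathcomp Require Export finmap.
From mathcomp Require Export multiset.
From mathcomp Require Import all_classical all_reals all_analysis.

Set Implicit Arguments.
Unset Strict Implicit.
Unset Printing Implicit Defensive.

Import Order.TTheory GRing.Theory Num.Theory.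

Local Open Scope classical_set_scope.
Local Open Scope ring_scope.

(* A realisation of a point process is a finite multiset of reals, and        *)
(* npts A B is |A \cap B|, counted with multiplicity.                         *)
Definition npts (R : realType) (A : {mset R}%mset) (B : set R) : nat :=
  count (fun x => x \in B) A.

(* Law and independence are stated for the counts on the Borel subsets of     *)
(* (0,1]. The library's poisson_prob ignores its second argument (hence the   *)
(* dummy 0) and is the Dirac mass at 0 when the rate is 0; poisson_pmf, which *)
(* is identically 1 at rate 0, would make the law wrong on null sets B.       *)
Record homogeneous_poisson_process (R : realType) (d : measure_display)
    (T : measurableType d) (P : probability T R) (lambda : R)
    (Pi : T -> {mset R}%mset) : Prop := HomogeneousPoissonProcess {
  hpp_support : forall (o : T) (x : R), x \in Pi o -> 0 < x <= 1 ;
  hpp_measurable : forall B : set R, measurable B -> B `<=` `]0, 1] ->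
    measurable_fun setT (fun o => npts (Pi o) B) ;
  hpp_law : forall B : set R, measurable B -> B `<=` `]0, 1] ->
    forall U : set nat,
      P [set o | U (npts (Pi o) B)] =
      poisson_prob (lambda * fine (lebesgue_measure B)) 0%N U ;
  hpp_indep : forall (m : nat) (B : 'I_m -> set R),
    (forall i, measurable (B i)) -> (forall i, B i `<=` `]0, 1]) ->
    trivIset setT B ->
    forall U : 'I_m -> set nat,
      P [set o | forall i, U i (npts (Pi o) (B i))] =
      (\prod_(i < m) P [set o | U i (npts (Pi o) (B i))])%E }.

(* max over 0 <= t <= 1 - w of |A \cap (t, t+w]|, as the largest value        *)
(* attained (the values are at most size A); see npts_le_scan and             *)
(* scan_attained.                                                             *)
Definition scan (R : realType) (w : R) (A : {mset R}%mset) : nat :=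
  \max_(j < (size A).+1 |
      `[< exists2 t : R, 0 <= t <= 1 - w & npts A `]t, t + w] = j >]) j.

Lemma npts_le_scan (R : realType) (w : R) (A : {mset R}%mset) (t : R) :
  0 <= t <= 1 - w -> (npts A `]t, (t + w)%R] <= scan w A)%N.
Proof.
move=> ht.
have hs : (npts A `]t, (t + w)%R] < (size A).+1)%N by rewrite ltnS count_size.
by apply: (@leq_bigmax_cond _ _ _ (Ordinal hs)); apply/asboolP; exists t.
Qed.

Lemma scan_attained (R : realType) (w : R) (A : {mset R}%mset) : w <= 1 ->
  exists2 t : R, 0 <= t <= 1 - w & npts A `]t, t + w] = scan w A.
Proof.
move=> w1.
have hs : (npts A `]0%R, (0 + w)%R] < (size A).+1)%N by rewrite ltnS count_size.
have h0 : `[< exists2 t : R, 0 <= t <= 1 - w &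
              npts A `]t, t + w] = Ordinal hs >].
  by apply/asboolP; exists 0; rewrite // lexx subr_ge0.
rewrite /scan (bigop.bigmax_eq_arg (Ordinal hs)) //.
by case: arg_maxnP => // j /asboolP.
Qed.

Definition occupied (R : realType) (n : nat) (A : {mset R}%mset) (i : nat) :
    bool :=
  npts A `](i%:R - 1) / n%:R, i%:R / n%:R] != 0%N.

(* The discretised scan statistic on n cells, with windows of l = nw cells.   *)
Definition discrete_scan (R : realType) (n l : nat) (A : {mset R}%mset) : nat :=
  \max_(1 <= i < (n - l).+2) \sum_(i <= r < i + l) occupied n A r.

Definition nu_event (R : realType) (w : R) (k : nat) (A : {mset R}%mset)
    (x : R) : bool :=
  [&& (scan w A < k)%N,
      npts A `]x, x + w] == (k - 2)%N &
      `[< forall t : R, x <= t <= x + w -> (npts A `]t, (t + w)%R] <= k - 2)%N >] ].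

(* The sums run over the points of A with multiplicity, so on the almost sure *)
(* event where the points are distinct they are sums over l = 1, ..., M.      *)
(* Natural subtraction in k - 2 is harmless as k >= 2.                        *)
Definition nu (R : realType) (w : R) (k : nat) (A : {mset R}%mset) : nat :=
  \sum_(x <- A | (x < 1 - w)%R) nu_event w k A x.

Definition nu_tilde (R : realType) (w : R) (k : nat) (A : {mset R}%mset) :
    nat :=
  \sum_(x <- A)
    ((scan w A < k)%N && (scan w (msetD A (msetn 1 x)) == k)).

Definition alpha (R : realType) (d : measure_display) (T : measurableType d)
    (P : probability T R) (w : R) (k : nat) (Pi : T -> {mset R}%mset) : \bar R :=
  P [set o | (k <= scan w (Pi o))%N].

Definition discrete_alpha (R : realType) (d : measure_display)
    (T : measurableType d) (P : probability T R) (n l k : nat)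
    (Pi : T -> {mset R}%mset) : \bar R :=
  P [set o | (k <= discrete_scan n l (Pi o))%N].

(* Main.v *)
Require Import Defs.
From mathcomp Require Import all_boot all_order all_algebra.
From mathcomp Require Import all_classical all_reals all_analysis.
From mathcomp Require Import measurable_realfun zify lra ring.

(** Cut (0, 1] into n = mq cells of length 1/n. The discrete scan is then the
    largest number of occupied cells in a window of l = mp consecutive cells.
    Such a window is one of the continuous windows, so alpha - alpha_n is the
    probability of the gap event, on which the scan reaches k and the discrete
    scan does not ([alpha_sub_discrete_alpha]).

    A window (t, t + w] that begins inside the cell i contains the cells
    i + 1, ..., i + l - 1 and cuts the cells i and i + l. The two scans can
    therefore differ only through a coincidence: two points in one cell, or
    one point in each of two cells at distance l ([scan_ltE],
    [discrete_scan_ltE]). With eps = lambda / n, a given coincidence has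
    probability of order eps^2 and there are O(n) of them, so that the gap
    event has probability O(1/n), while two coincidences occur together with
    probability O(1/n^2) only ([prob_clumped_le]). These orders are the same if
    two occupied cells at distance 2l count as a coincidence too; they do not
    separate the scans, but excluding them makes the decomposition below unique.
    What remains are the configurations with exactly one coincidence, in one
    cell or at distance l. Each of them arises, in one
    way, from a configuration S without coincidences by adding a point, either
    to an occupied cell i or to the cell i + l ([scan_gap_configuration],
    [add_at_inj]).

    If the point is added to the cell i, the probability of the configuration
    is multiplied by eps / 2, the ratio of the Poisson masses at 2 and 1, and
    the gap event occurs exactly if doubling the point of the cell i raises the
    scan from below k to k: nu_tilde counts these i ([doubled_cellE],
    [nu_tilde_pointE]).

    If the point is added to the cell i + l, the probability is multiplied by
    eps. The gap event occurs exactly if the discrete windows stay below k,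
    there are k - 2 points in the cells between, and the two points are less
    than w apart. The first two conditions are those that nu counts
    ([nu_pointE]); the third one compares the positions of two points within
    their cells, which are independent and equally distributed, so it has
    conditional probability 1/2 ([prob_gap_partner]).

    Summation over S and i shows that, up to O(1/n^2), the gap event has
    probability eps / 2 times the expectation of nu + nu_tilde over the
    configurations without coincidences. As nu + nu_tilde is bounded, a scan
    below k leaving room for boundedly many points, the coincidences change
    this expectation by O(1/n) only ([gap_asymptotics]). *)

Import Order.TTheory GRing.Theory Num.Theory.
Import numFieldNormedType.Exports.

Set Implicit Arguments.
Unset Strict Implicit.
Unset Printing Implicit Defensive.

Local Open Scope classical_set_scope.
Local Open Scope ring_scope.

Local Notation npts_oc A a b := (npts A `]a%R, b%R]).

(** * Counts per cell and their sums over windows *)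

Definition window_sum (l : nat) (c : nat -> nat) (s : nat) : nat :=
  (\sum_(s <= r < s + l) c r)%N.

(** These cells lie in every window that begins inside the cell s. *)
Definition inner_sum (l : nat) (c : nat -> nat) (s : nat) : nat :=
  (\sum_(s.+1 <= r < s + l) c r)%N.

(** Cells are numbered from 0; the windows that fit into n cells begin at the
    cells 0, ..., n - l. *)
Definition windows_below (n l k : nat) (c : nat -> nat) : bool :=
  [forall s : 'I_(n - l).+1, (window_sum l c s < k)%N].

Definition add_at (c : nat -> nat) (j r : nat) : nat := (c r + (r == j))%N.

Lemma windows_belowP (n l k : nat) (c : nat -> nat) :
  reflect (forall s, (s <= n - l)%N -> (window_sum l c s < k)%N)
    (windows_below n l k c).
Proof.
apply: (iffP forallP) => [h s sn|h s]; first exact: (h (Ordinal (sn : (s < (n - l).+1)%N))).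
by apply: h; rewrite -ltnS.
Qed.

Lemma window_sum_recl (l : nat) (c : nat -> nat) (s : nat) : (0 < l)%N ->
  window_sum l c s = (c s + inner_sum l c s)%N.
Proof. by move=> l0; rewrite /window_sum big_ltn // -{1}(addn0 s) ltn_add2l. Qed.

Lemma window_sum_recr (l : nat) (c : nat -> nat) (s : nat) : (0 < l)%N ->
  window_sum l c s.+1 = (inner_sum l c s + c (s + l))%N.
Proof.
by move=> l0; rewrite /window_sum addSn big_nat_recr //= -{1}(addn0 s) ltn_add2l.
Qed.

Lemma eq_window_sum (l s : nat) (c c' : nat -> nat) :
  c =1 c' -> window_sum l c s = window_sum l c' s.
Proof. by move=> cc'; apply: eq_bigr => r _; rewrite cc'. Qed.

Lemma eq_windows_below (n l k : nat) (c c' : nat -> nat) :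
  c =1 c' -> windows_below n l k c = windows_below n l k c'.
Proof. by move=> cc'; apply: eq_forallb => s; rewrite (eq_window_sum _ _ cc'). Qed.

Lemma sum_nat_eq (m n j : nat) :
  (\sum_(m <= r < n) (r == j :> nat))%N = (m <= j < n)%N.
Proof.
rewrite big_nat_cond (eq_bigr (fun r => if r == j then 1%N else 0%N)); last first.
  by move=> r _; case: eqP.
rewrite -big_mkcondr /= sum1_count.
have [mj|mj] := boolP (m <= j < n)%N.
  rewrite (eq_in_count (a2 := pred1 j)); last first.
    by move=> r; rewrite mem_index_iota /= => ->.
  by rewrite count_uniq_mem ?iota_uniq // mem_index_iota mj.
rewrite (eq_in_count (a2 := pred0)) ?count_pred0 // => r /=.
by rewrite mem_index_iota => hr; rewrite hr /=; apply/eqP => rj; move: mj; rewrite -rj hr.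
Qed.

Lemma window_sum_add (l : nat) (c : nat -> nat) (j s : nat) :
  window_sum l (add_at c j) s = (window_sum l c s + (s <= j < s + l))%N.
Proof. by rewrite /window_sum big_split /= sum_nat_eq. Qed.

Lemma windows_below_add (n l k : nat) (c : nat -> nat) (j : nat) :
  windows_below n l k c -> windows_below n l k.+1 (add_at c j).
Proof.
move=> /windows_belowP h; apply/windows_belowP => s /h; rewrite window_sum_add.
by case: (s <= j < s + l)%N; rewrite ?addn0 ?addn1 ?ltnS // => /ltnW.
Qed.

Lemma windows_below_of_add (n l k : nat) (c : nat -> nat) (j : nat) :
  windows_below n l k (add_at c j) -> windows_below n l k c.
Proof.
move=> /windows_belowP h; apply/windows_belowP => s /h; rewrite window_sum_add.
by apply: leq_ltn_trans; rewrite leq_addr.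
Qed.

(** * Points of a multiset on the grid of mesh 1/n *)

Section Counting.
Context {R : realType}.
Implicit Types (A : {mset R}%mset) (a b t x : R).

Lemma npts_itvE A a b : npts_oc A a b = count (fun x => a < x <= b) A.
Proof.
apply: eq_count => x; apply/idP/idP; first by move/set_mem; rewrite /= in_itv.
by move=> h; apply/mem_set; rewrite /= in_itv.
Qed.

Lemma npts_le_in A (a b a' b' : R) :
  (forall x, x \in A -> a < x <= b -> a' < x <= b') ->
  (npts_oc A a b <= npts_oc A a' b')%N.
Proof.
move=> h; rewrite !npts_itvE.
rewrite (eq_in_count (a2 := fun x => (a < x <= b) && (a' < x <= b'))).
  by apply: sub_count => x /andP[].
by move=> x xA; case: (boolP (a < x <= b)) => //= /(h x xA) ->.
Qed.

Lemma npts_le_sub A (a b a' b' : R) : a' <= a -> b <= b' ->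
  (npts_oc A a b <= npts_oc A a' b')%N.
Proof.
move=> aa bb; apply: npts_le_in => x _ /andP[ax xb].
by rewrite (le_lt_trans aa ax) (le_trans xb bb).
Qed.

Lemma npts_cat A (a b c : R) : a <= b -> b <= c ->
  npts_oc A a c = (npts_oc A a b + npts_oc A b c)%N.
Proof.
move=> ab bc; rewrite !npts_itvE -count_predUI.
rewrite [X in (_ = _ + X)%N](_ : _ = 0%N); last first.
  apply/eqP; rewrite -leqn0 leqNgt -has_count; apply/hasPn => x _ /=.
  by apply/negP; lra.
rewrite addn0; apply: eq_count => x /=.
apply/idP/idP; last by move=> /orP[]/andP[? ?]; apply/andP; lra.
by move=> /andP[ax xc]; rewrite ax xc andbT; case: (leP x b).
Qed.

Lemma npts_add A x (a b : R) :
  npts_oc (msetD A (msetn 1 x)) a b = (npts_oc A a b + (a < x <= b)%R)%N.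
Proof.
have h : perm_eq (msetD A (msetn 1 x)) (x :: A).
  apply/allP => y _; apply/eqP => /=.
  by rewrite !count_mem_mset msetE2 msetnE addnC (eq_sym x); case: eqP.
by rewrite !npts_itvE (permP h) /= addnC.
Qed.

Lemma npts_gt0P A (a b : R) :
  reflect (exists2 x, x \in A & a < x <= b) (0 < npts_oc A a b)%N.
Proof. by rewrite npts_itvE -has_count; apply: hasP. Qed.

Lemma npts_eq0 A (a b : R) :
  (forall x, x \in A -> ~~ (a < x <= b)) -> npts_oc A a b = 0%N.
Proof.
by move=> h; apply/eqP; rewrite -leqn0 leqNgt; apply/npts_gt0P => -[x /h /negP].
Qed.

Lemma npts_mem_gt0 A x (a b : R) : x \in A -> a < x <= b -> (0 < npts_oc A a b)%N.
Proof. by move=> xA hx; apply/npts_gt0P; exists x. Qed.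
End Counting.

Definition cell_count {R : realType} (n : nat) (A : {mset R}%mset) (r : nat) : nat :=
  npts_oc A (r%:R / n%:R) (r.+1%:R / n%:R).

Section GridPoints.
Context {R : realType}.
Variables (n : nat).
Hypothesis n_pos : (0 < n)%N.

Let n_gt0 : 0 < n%:R :> R.
Proof. by rewrite ltr0n. Qed.

Lemma le_grid (i j : nat) : (i%:R / n%:R <= j%:R / n%:R :> R) = (i <= j)%N.
Proof. by rewrite ler_pM2r ?invr_gt0 // ler_nat. Qed.

Lemma lt_grid (i j : nat) : (i%:R / n%:R < j%:R / n%:R :> R) = (i < j)%N.
Proof. by rewrite ltr_pM2r ?invr_gt0 // ltr_nat. Qed.

Lemma grid_one : n%:R / n%:R = 1 :> R.
Proof. by rewrite divff // gt_eqF. Qed.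

Lemma grid_refine (H j : nat) : (0 < H)%N ->
  j%:R / n%:R = (j * H)%:R / (n * H)%:R :> R.
Proof.
by move=> H0; rewrite !natrM -mulf_div divff ?mulr1 // pnatr_eq0 -lt0n.
Qed.

Lemma exists_cell_ge (t : R) : 0 <= t -> exists i : nat, i%:R / n%:R <= t < i.+1%:R / n%:R.
Proof.
move=> t0; exists (Num.truncn (t * n%:R)).
by rewrite ler_pdivrMr // ltr_pdivlMr // truncn_itv // mulr_ge0 // ltW.
Qed.

Lemma exists_cell_gt (t : R) : 0 < t -> exists i : nat, i%:R / n%:R < t <= i.+1%:R / n%:R.
Proof.
move=> t0; have [i /andP[i1 i2]] := exists_cell_ge (ltW t0).
move: i1; rewrite le_eqVlt => /predU1P[ti|i1]; last by exists i; rewrite i1 ltW.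
case: i ti i2 => [|i] ti i2; first by move: t0; rewrite -ti mul0r ltxx.
by exists i; rewrite -ti lexx andbT lt_grid.
Qed.

Lemma npts_grid (A : {mset R}%mset) (i j : nat) : (i <= j)%N ->
  npts_oc A (i%:R / n%:R) (j%:R / n%:R) = (\sum_(i <= r < j) cell_count n A r)%N.
Proof.
elim: j => [|j IH]; first by
  rewrite leqn0 => /eqP->; rewrite big_geq // npts_eq0 // => x _; apply/negP; lra.
rewrite leq_eqVlt => /predU1P[->|]; first by rewrite big_geq // npts_eq0 // => x _; apply/negP; lra.
rewrite ltnS => ij; rewrite big_nat_recr //= -IH //.
by rewrite (@npts_cat _ A _ (j%:R / n%:R)) // le_grid.
Qed.

Lemma cell_count_ge (A : {mset R}%mset) (r : nat) :
  (forall x, x \in A -> 0 < x <= 1) -> (n <= r)%N -> cell_count n A r = 0%N.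
Proof.
move=> supp nr; apply: npts_eq0 => x /supp /andP[_ x1]; apply/negP => /andP[h _].
by rewrite -[leRHS]grid_one in x1; move: (lt_le_trans h x1); rewrite lt_grid ltnNge nr.
Qed.

End GridPoints.

Section Grid.
Context {R : realType}.
Variables (n l : nat) (w : R) (A : {mset R}%mset).
Hypotheses (l_gt0 : (0 < l)%N) (l_lt_n : (l < n)%N) (wE : w = l%:R / n%:R).
Hypothesis supp : forall x, x \in A -> 0 < x <= 1.

Let c := cell_count n A.
Let n_pos : (0 < n)%N.
Proof. by lia. Qed.
Let n_gt0 : 0 < n%:R :> R.
Proof. by rewrite ltr0n. Qed.
Let n_neq0 : n%:R != 0 :> R.
Proof. by rewrite gt_eqF. Qed.

Lemma grid_addw (i : nat) : i%:R / n%:R + w = (i + l)%:R / n%:R.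
Proof. by rewrite wE -mulrDl natrD. Qed.

Lemma grid_subw : 1 - w = (n - l)%:R / n%:R.
Proof. by rewrite wE natrB ?(ltnW l_lt_n)// mulrBl divff. Qed.

Lemma npts_window_grid (s : nat) :
  npts_oc A (s%:R / n%:R) (s%:R / n%:R + w) = window_sum l c s.
Proof. by rewrite grid_addw npts_grid // leq_addr. Qed.

(** The upper end of the range of t is included so that a point at the right
    end of its cell can serve as t. *)
Lemma npts_window_split (i : nat) (t : R) :
  i%:R / n%:R <= t <= i.+1%:R / n%:R ->
  npts_oc A t (t + w) = (npts_oc A t (i.+1%:R / n%:R) + inner_sum l c i
                          + npts_oc A ((i + l)%:R / n%:R) (t + w))%N.
Proof.
move=> /andP[it ti].
have h1 : (i.+1%:R / n%:R : R) <= (i + l)%:R / n%:R by rewrite le_grid //; lia.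
have h2 : (i + l)%:R / n%:R <= t + w by rewrite -grid_addw lerD2r.
rewrite (@npts_cat _ A _ (i.+1%:R / n%:R)) ?(le_trans h1) //.
by rewrite (@npts_cat _ A (i.+1%:R / n%:R) ((i + l)%:R / n%:R)) // npts_grid ?addnA //; lia.
Qed.

Lemma npts_window_split_le (i : nat) (t : R) :
  i%:R / n%:R <= t <= i.+1%:R / n%:R ->
  (npts_oc A t (i.+1%:R / n%:R) <= c i)%N /\
  (npts_oc A ((i + l)%:R / n%:R) (t + w) <= c (i + l))%N.
Proof.
move=> /andP[it ti]; split; apply: npts_le_sub => //.
by rewrite -addSn -grid_addw lerD2r.
Qed.

(** If one of the two cells that the window cuts is empty, the part of the
    other one can be completed to the whole cell, which gives a window of
    whole cells. *)
Lemma npts_window_le (i : nat) (t : R) :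
  i%:R / n%:R <= t <= i.+1%:R / n%:R -> c i = 0%N \/ c (i + l) = 0%N ->
  (npts_oc A t (t + w) <= maxn (window_sum l c i) (window_sum l c i.+1))%N.
Proof.
move=> ht; have [h1 h2] := npts_window_split_le ht.
rewrite (npts_window_split ht) window_sum_recl // window_sum_recr //; lia.
Qed.

Lemma window_sum_le_scan (s : nat) : (s <= n - l)%N -> (window_sum l c s <= scan w A)%N.
Proof.
move=> sn; rewrite -npts_window_grid; apply: npts_le_scan.
by rewrite grid_subw le_grid // sn divr_ge0 ?ler0n // ltW.
Qed.

Lemma scan_lt_windows_below (k : nat) :
  (scan w A < k)%N -> windows_below n l k c.
Proof. by move=> h; apply/windows_belowP => s /window_sum_le_scan /leq_ltn_trans; apply. Qed.

Lemma w_le1 : w <= 1.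
Proof. by rewrite wE -[leRHS](grid_one n_pos) le_grid // ltnW. Qed.

(** Windows that begin at grid points are continuous windows; conversely every
    continuous window cuts two cells at distance l, one of which is empty, and
    [npts_window_le] applies. *)
Lemma scan_ltE (k : nat) : (forall s, c s = 0%N \/ c (s + l) = 0%N) ->
  (scan w A < k)%N = windows_below n l k c.
Proof.
move=> far; apply/idP/idP; first exact: scan_lt_windows_below.
move=> /windows_belowP h; have [t /andP[t0 t1] <-] := scan_attained A w_le1.
have [i /andP[i1 i2]] := exists_cell_ge n_pos t0.
have iw : (i <= n - l)%N.
  by rewrite -(le_grid (R := R) n_pos) -grid_subw; apply: le_trans t1.
apply: leq_ltn_trans (npts_window_le _ (far i)) _.
  by rewrite i1 ltW.
rewrite gtn_max h //=.
have [iw'|iw'] := ltnP i (n - l); first exact: h.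
have cz : c (i + l) = 0%N by apply: (cell_count_ge n_pos supp); lia.
apply: leq_ltn_trans (h i iw).
by rewrite window_sum_recr // (@window_sum_recl l c i) // cz addn0 leq_addl.
Qed.

(** The discrete scan sees the configuration with all multiplicities reduced
    to one. *)
Lemma discrete_scan_ltE (k : nat) : (0 < k)%N ->
  (discrete_scan n l A < k)%N = windows_below n l k (fun r => (c r != 0)%N : nat).
Proof.
case: k => // k _; rewrite ltnS.
have e s : (\sum_(s.+1 <= r < s.+1 + l) occupied n A r)%N
     = window_sum l (fun r => (c r != 0)%N : nat) s.
  rewrite /window_sum addSn big_add1 /=; apply: eq_bigr => r _.
  by rewrite /occupied -natr1 addrK natr1.
apply/bigmax_leqP_seq/windows_belowP => [h s sn|h i].
  by rewrite ltnS -e; apply: h => //; rewrite mem_index_iota; lia.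
by rewrite mem_index_iota; case: i => // s hs _; rewrite e -ltnS; apply: h; lia.
Qed.

End Grid.

(** * Sparse configurations and configurations with one coincidence *)

(** A configuration with at most one point per cell is a list of booleans; as a
    count function on all of nat it vanishes beyond the end of the list, so that
    cells shifted by l need no bounds. *)
Definition conf (S : seq bool) (r : nat) : nat := nth false S r.

(** Distance 2l is excluded as well, so that the cell i + 2l is empty when a
    point is added to the cell i + l, and this point has only the one of the
    cell i at distance l. *)
Definition sparse (l : nat) (S : seq bool) : bool :=
  all (fun i => nth false S i ==> ~~ (nth false S (i + l) || nth false S (i + l + l)))
    (iota 0 (size S)).

Lemma sparseP (l : nat) (S : seq bool) :
  reflect (forall i, nth false S i ->
             nth false S (i + l) = false /\ nth false S (i + l + l) = false)
    (sparse l S).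
Proof.
apply: (iffP allP) => [h i Si|h i _].
  have := h i; rewrite mem_iota /= add0n Si /=.
  have -> : (i < size S)%N by rewrite ltnNge; apply/negP => /(nth_default false); rewrite Si.
  by move=> /(_ isT) /norP[/negbTE-> /negbTE->].
by apply/implyP => /h[-> ->].
Qed.

(** The summand of nu_tilde for the point of the cell i, in terms of the cells. *)
Definition doubling_raises (n l k : nat) (S : seq bool) (i : nat) : bool :=
  windows_below n l k (conf S) && ~~ windows_below n l k (add_at (conf S) i).

(** The summand of nu for the point of the cell i, in terms of the cells: a
    point could be added to the cell i + l with all windows of whole cells
    staying below k, while a window that cuts the cells i and i + l and
    contains their two points would reach k. *)
Definition partner_tight (n l k : nat) (S : seq bool) (i : nat) : bool :=
  [&& (i + l < n)%N, windows_below n l k (add_at (conf S) (i + l)) &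
      inner_sum l (conf S) i == (k - 2)%N].

Section Configurations.
Context {R : realType}.
Variables (n l k : nat) (w : R) (A : {mset R}%mset) (S : seq bool).
Hypotheses (l_gt0 : (0 < l)%N) (l_lt_n : (l < n)%N) (wE : w = l%:R / n%:R).
Hypothesis k_ge2 : (2 <= k)%N.
Hypothesis supp : forall x, x \in A -> 0 < x <= 1.
Hypothesis S_sparse : sparse l S.

Let n_gt0 : 0 < n%:R :> R.
Proof. by rewrite ltr0n; lia. Qed.
Let w_gt0 : 0 < w.
Proof. by rewrite wE divr_gt0 // ltr0n. Qed.
Let k_gt0 : (0 < k)%N.
Proof. exact: ltnW. Qed.
Let n_pos : (0 < n)%N.
Proof. lia. Qed.

Lemma conf_far (s : nat) : conf S s = 0%N \/ conf S (s + l) = 0%N.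
Proof.
rewrite /conf; case: (boolP (nth false S s)) => [h|]; last by left.
by right; have [->] := sparseP _ _ S_sparse _ h.
Qed.

Lemma add_at_far (i s : nat) : nth false S i ->
  add_at (conf S) i s = 0%N \/ add_at (conf S) i (s + l) = 0%N.
Proof.
move=> Si; rewrite /add_at /conf.
have [h1|h1] := boolP (nth false S s); last first.
  by left; have [si|//] := eqVneq s i; rewrite si Si in h1.
right; have [e _] := sparseP _ _ S_sparse _ h1; rewrite e.
by have [si|//] := eqVneq (s + l)%N i; rewrite si Si in e.
Qed.

(** Two points in one cell are seen by the continuous windows and not by the
    discrete ones, for which the configuration is still S. *)
Lemma doubled_cellE (i : nat) : nth false S i ->
  cell_count n A =1 add_at (conf S) i ->
  (k <= scan w A)%N && (discrete_scan n l A < k)%N = doubling_raises n l k S i.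
Proof.
move=> Si cA; rewrite leqNgt (scan_ltE l_gt0 l_lt_n wE supp); last first.
  by move=> s; rewrite !cA; apply: add_at_far.
rewrite (discrete_scan_ltE A l_gt0 l_lt_n) // (eq_windows_below _ _ _ cA) andbC.
congr (_ && _); apply: eq_windows_below => r; rewrite cA /add_at /conf.
by have [->|_] := eqVneq r i; rewrite ?Si //; case: nth.
Qed.

Lemma occupied_lt_size (i : nat) : nth false S i -> (i < size S)%N.
Proof. by move=> h; rewrite ltnNge; apply/negP => /(nth_default false); rewrite h. Qed.

Section Partner.
Variable i : nat.
Hypotheses (Si : nth false S i) (il_lt_n : (i + l < n)%N).
Hypothesis cA : cell_count n A =1 add_at (conf S) (i + l).

Let Sil : nth false S (i + l) = false.
Proof. by have [->] := sparseP _ _ S_sparse _ Si. Qed.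

Let Sill : nth false S (i + l + l) = false.
Proof. by have [_ ->] := sparseP _ _ S_sparse _ Si. Qed.

Let ci : cell_count n A i = 1%N.
Proof. by rewrite cA /add_at /conf Si; have -> : (i == i + l)%N = false by lia. Qed.

Let cil : cell_count n A (i + l) = 1%N.
Proof. by rewrite cA /add_at /conf Sil eqxx. Qed.

Lemma partner_far (s : nat) : s <> i ->
  cell_count n A s = 0%N \/ cell_count n A (s + l) = 0%N.
Proof.
move=> si; rewrite !cA /add_at /conf eqn_add2r (introF eqP si) addn0.
have [->|sil] := eqVneq s (i + l)%N; first by rewrite Sill; right.
have [h|] := boolP (nth false S s); last by left; rewrite addn0.
by right; have [->] := sparseP _ _ S_sparse _ h.
Qed.

Lemma partner_discrete :
  (discrete_scan n l A < k)%N = windows_below n l k (add_at (conf S) (i + l)).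
Proof.
rewrite (discrete_scan_ltE A l_gt0 l_lt_n) //; apply: eq_windows_below => r.
rewrite cA /add_at /conf; have [->|_] := eqVneq r (i + l)%N; first by rewrite Sil.
by rewrite addn0; case: nth.
Qed.

Lemma inner_sum_partner : inner_sum l (cell_count n A) i = inner_sum l (conf S) i.
Proof.
rewrite /inner_sum; rewrite big_nat_cond [RHS]big_nat_cond; apply: eq_bigr => r.
by move=> /andP[/andP[_ h] _]; rewrite cA /add_at (ltn_eqF h) addn0.
Qed.

(** A window with k points begins in the cell i, since elsewhere one of the
    cells that it cuts is empty. It contains both points, because k - 2 points
    at most are left for the cells between. As it has length w, the point of
    the cell i + l is then less than w away from that of the cell i; in terms
    of H equal parts of the cells, it cannot be in a later part. *)
Lemma partner_crossing_of_scan (H : nat) : (0 < H)%N ->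
  (k <= scan w A)%N -> (discrete_scan n l A < k)%N ->
  partner_tight n l k S i /\
  exists a b, [/\ (b <= a < H)%N, (0 < cell_count (n * H) A (i * H + a))%N &
                  (0 < cell_count (n * H) A ((i + l) * H + b))%N].
Proof.
move=> H0 kA; rewrite partner_discrete => low.
have /windows_belowP lowA : windows_below n l k (cell_count n A).
  by rewrite (eq_windows_below _ _ _ cA).
have [t /andP[t0 t1] tA] := scan_attained A (w_le1 l_gt0 l_lt_n wE).
have [s /andP[s1 s2]] := exists_cell_ge n_pos t0.
have st : s%:R / n%:R <= t <= s.+1%:R / n%:R by rewrite s1 ltW.
have snl : (s <= n - l)%N.
  by rewrite -(le_grid (R := R) n_pos) -(grid_subw l_gt0 l_lt_n wE); apply: le_trans t1.
have si : s = i.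
  apply/eqP; apply: contraT => /eqP /partner_far far.
  have := npts_window_le l_gt0 l_lt_n wE st far; rewrite tA leqNgt.
  have [sl|sl] := ltnP s (n - l); first by rewrite (leq_trans _ kA) // gtn_max !lowA.
  have cz : cell_count n A (s + l) = 0%N.
    by apply: (cell_count_ge n_pos supp); rewrite addnC -leq_subLR.
  rewrite window_sum_recr // cz (@window_sum_recl l _ s) //.
  have := lowA s snl; rewrite window_sum_recl // addn0 => hs.
  by rewrite (leq_trans _ kA) // gtn_max hs (leq_ltn_trans _ hs) ?leq_addl.
subst s; have [p1 p2] := npts_window_split_le A wE st.
rewrite ci in p1; rewrite cil in p2.
have := npts_window_split A l_gt0 l_lt_n wE st; rewrite tA inner_sum_partner => sc.
have := lowA i snl; rewrite window_sum_recl // ci inner_sum_partner => in1.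
have pp1 : (0 < npts_oc A t (i.+1%:R / n%:R))%N.
  by clear - p1 p2 sc in1 kA; lia.
have pp2 : (0 < npts_oc A ((i + l)%:R / n%:R) (t + w))%N.
  by clear - p1 p2 sc in1 kA; lia.
split; first by rewrite /partner_tight il_lt_n low /=; apply/eqP;
  clear - p1 p2 sc in1 kA; lia.
have [x xA /andP[x1 x2]] := npts_gt0P _ _ _ pp1.
have [y yA /andP[y1 y2]] := npts_gt0P _ _ _ pp2.
have nH0 : (0 < n * H)%N by rewrite muln_gt0 n_pos.
have gridH := fun j : nat => @grid_refine R n H j H0.
have [x0 _] := andP (supp xA); have [y0 _] := andP (supp yA).
have [j /andP[j1 j2]] := exists_cell_gt nH0 x0.
have [j' /andP[j'1 j'2]] := exists_cell_gt nH0 y0.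
have b1 : (i * H < j.+1)%N.
  rewrite -(lt_grid (R := R) nH0) -gridH; apply: lt_le_trans j2.
  by apply: le_lt_trans x1.
have b2 : (j < i.+1 * H)%N.
  by rewrite -(lt_grid (R := R) nH0) -gridH; apply: lt_le_trans j1 x2.
have b3 : ((i + l) * H < j'.+1)%N.
  by rewrite -(lt_grid (R := R) nH0) -gridH; apply: lt_le_trans j'2.
have b4 : (j' < j.+1 + l * H)%N.
  rewrite -(lt_grid (R := R) nH0) natrD mulrDl -gridH -wE.
  by apply: lt_trans j'1 _; apply: le_lt_trans y2 _; rewrite ltrD2r; apply: lt_le_trans j2.
exists (j - i * H)%N, (j' - (i + l) * H)%N; split.
- by rewrite mulSn in b2; rewrite mulnDl in b3 *; clear - b1 b2 b3 b4; lia.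
- by apply: (npts_mem_gt0 xA); rewrite subnKC ?j1 // -ltnS.
- by apply: (npts_mem_gt0 yA); rewrite subnKC ?j'1 // -ltnS.
Qed.

(** If the point of the cell i is in a strictly later part of its cell than
    the point of the cell i + l, the window that begins with this part
    contains both. *)
Lemma scan_of_partner_crossing (H a b : nat) : (b < a < H)%N ->
  partner_tight n l k S i ->
  (0 < cell_count (n * H) A (i * H + a))%N ->
  (0 < cell_count (n * H) A ((i + l) * H + b))%N ->
  (k <= scan w A)%N && (discrete_scan n l A < k)%N.
Proof.
move=> /andP[ba aH] /and3P[_ low /eqP inn] pa pb; rewrite partner_discrete low andbT.
have H0 : (0 < H)%N by apply: leq_ltn_trans aH.
have nH0 : (0 < n * H)%N by rewrite muln_gt0 n_pos.
have gridH := fun j : nat => @grid_refine R n H j H0.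
pose t : R := (i * H + a)%:R / (n * H)%:R.
have it : i%:R / n%:R <= t <= i.+1%:R / n%:R.
  by rewrite !gridH !le_grid // leq_addr mulSn addnC leq_add2r ltnW.
have t0 : 0 <= t <= 1 - w.
  rewrite (grid_subw l_gt0 l_lt_n wE) divr_ge0 ?ler0n //=.
  by have /andP[_ h] := it; apply: le_trans h _; rewrite le_grid //;
     clear - il_lt_n; lia.
apply: leq_trans (npts_le_scan A t0).
rewrite (npts_window_split A l_gt0 l_lt_n wE it) inner_sum_partner inn.
suff : (0 < npts_oc A t (i.+1%:R / n%:R))%N /\
       (0 < npts_oc A ((i + l)%:R / n%:R) (t + w))%N.
  by clear - k_ge2; lia.
split.
  apply: leq_trans pa _; apply: npts_le_sub => //.
  by rewrite gridH le_grid // mulSn -addnS addnC leq_add2r.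
apply: leq_trans pb _; apply: npts_le_sub; first by rewrite gridH le_grid // leq_addr.
by rewrite wE gridH /t -mulrDl -natrD le_grid // mulnDl; clear - ba; lia.
Qed.
End Partner.

Section Functionals.
Hypothesis cA : cell_count n A =1 conf S.

Lemma scan_lt_conf (j : nat) : (scan w A < j)%N = windows_below n l j (conf S).
Proof.
rewrite (scan_ltE l_gt0 l_lt_n wE supp); first exact: eq_windows_below.
by move=> s; rewrite !cA; apply: conf_far.
Qed.

Lemma in_cell_eq (x : R) (i r : nat) : i%:R / n%:R < x <= i.+1%:R / n%:R ->
  (r%:R / n%:R < x <= r.+1%:R / n%:R) = (r == i).
Proof.
move=> /andP[x1 x2]; apply/idP/eqP => [/andP[r1 r2]|->]; last by rewrite x1.
have := lt_le_trans x1 r2; have := lt_le_trans r1 x2; rewrite !lt_grid // => h1 h2.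
by apply/eqP; rewrite eqn_leq -ltnS h1 -ltnS h2.
Qed.

(** One point raises a window by at most one, so a scan that was below k and
    reaches k is equal to k. *)
Lemma nu_tilde_pointE (x : R) (i : nat) : x \in A ->
  i%:R / n%:R < x <= i.+1%:R / n%:R ->
  (scan w A < k)%N && (scan w (msetD A (msetn 1 x)) == k)
  = doubling_raises n l k S i.
Proof.
move=> xA xi; rewrite /doubling_raises scan_lt_conf.
have Si : nth false S i.
  by have := npts_mem_gt0 xA xi; rewrite -/(cell_count n A i) cA /conf; case: nth.
have cAx : cell_count n (msetD A (msetn 1 x)) =1 add_at (conf S) i.
  by move=> r; rewrite /cell_count npts_add (in_cell_eq _ xi) -/(cell_count n A r) cA.
have sAx y : y \in msetD A (msetn 1 x) -> 0 < y <= 1.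
  by rewrite in_msetD in_mset1 => /orP[/supp //|/eqP->]; apply: supp.
have e j : (scan w (msetD A (msetn 1 x)) < j)%N = windows_below n l j (add_at (conf S) i).
  rewrite (scan_ltE l_gt0 l_lt_n wE sAx); first exact: eq_windows_below.
  by move=> s; rewrite !cAx; apply: add_at_far.
case: (boolP (windows_below n l k (conf S))) => //= low.
by rewrite eqn_leq -ltnS e windows_below_add //= leqNgt e.
Qed.

(** Adding a point to the cell i + l affects the windows of whole cells that
    begin in one of the cells i + 1, ..., i + l. These begin between x and
    x + w, which gives one direction. Conversely, a window that begins between
    x and x + w either begins in the cell i and contains just the cells
    between, or it is dominated by one of these windows of whole cells, by
    sparsity; one that begins after 1 - w contains no more points than the
    one that begins at 1 - w. The point 1 - w itself is the right end of the
    cell n - l - 1, where x < 1 - w and i + l < n disagree. *)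
Lemma nu_pointE (x : R) (i : nat) : x \in A -> 1 - w \notin A ->
  i%:R / n%:R < x <= i.+1%:R / n%:R ->
  (x < 1 - w) && nu_event w k A x = partner_tight n l k S i.
Proof.
move=> xA wA xi; have /andP[x1 x2] := xi.
have Si : nth false S i.
  by have := npts_mem_gt0 xA xi; rewrite -/(cell_count n A i) cA /conf; case: nth.
have [Sil Sill] := sparseP _ _ S_sparse _ Si.
have ci : cell_count n A i = 1%N by rewrite cA /conf Si.
have cil : cell_count n A (i + l) = 0%N by rewrite cA /conf Sil.
have cill : cell_count n A (i + l + l) = 0%N by rewrite cA /conf Sill.
have part0 : npts_oc A x (i.+1%:R / n%:R) = 0%N.
  have h : (0 < npts_oc A (i%:R / n%:R) x)%N.
    by apply: (npts_mem_gt0 xA); rewrite x1 lexx.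
  have : (npts_oc A (i%:R / n%:R) x + npts_oc A x (i.+1%:R / n%:R))%N = 1%N.
    by rewrite -npts_cat // ltW.
  by clear - h; lia.
have innE : inner_sum l (cell_count n A) i = inner_sum l (conf S) i.
  by apply: eq_bigr => r _; rewrite cA.
(* x is the only point of its cell and the cell i + l is empty *)
have first_cell t : x <= t <= i.+1%:R / n%:R ->
    npts_oc A t (t + w) = inner_sum l (conf S) i.
  move=> /andP[xt ti].
  have it : i%:R / n%:R <= t <= i.+1%:R / n%:R by rewrite ti (le_trans (ltW x1) xt).
  have [_] := npts_window_split_le A wE it; rewrite cil leqn0 => /eqP p2.
  rewrite (npts_window_split A l_gt0 l_lt_n wE it) p2 addn0 innE.
  suff -> : npts_oc A t (i.+1%:R / n%:R) = 0%N by [].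
  by apply/eqP; rewrite -leqn0 -part0; apply: npts_le_sub.
have winE s : window_sum l (conf S) s = window_sum l (cell_count n A) s.
  by apply: eq_bigr => r _; rewrite cA.
apply/andP/and3P.
- move=> [xw /and3P[sk /eqP xk /asboolP all_t]].
  have il : (i + l < n)%N.
    have : i%:R / n%:R < 1 - w by apply: lt_trans xw.
    by rewrite (grid_subw l_gt0 l_lt_n wE) lt_grid // ltn_subRL addnC.
  split=> //; last by rewrite -(first_cell x) ?lexx //; apply/eqP.
  apply/windows_belowP => s snl; rewrite window_sum_add.
  have := sk; rewrite scan_lt_conf => /windows_belowP /(_ s snl).
  have [/andP[sil ils]|_] := boolP (s <= i + l < s + l)%N; last by rewrite addn0.
  move=> _; rewrite winE -(npts_window_grid A l_gt0 l_lt_n wE).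
  have : (npts_oc A (s%:R / n%:R) (s%:R / n%:R + w) <= k - 2)%N.
    apply: all_t; apply/andP; split; first by apply: le_trans x2 _; rewrite le_grid // -(ltn_add2r l).
    apply: (@le_trans _ _ ((i + l)%:R / n%:R)); first by rewrite le_grid.
    by rewrite -(grid_addw wE) lerD2r ltW.
  by clear - k_ge2; lia.
- move=> [il low /eqP inn].
  have lowS := windows_below_of_add low.
  have win_le s : (s <= n - l)%N -> (i < s <= i + l)%N ->
      (window_sum l (conf S) s <= k - 2)%N.
    by move=> snl sil; have := windows_belowP _ _ _ _ low s snl; rewrite window_sum_add;
       clear - sil; lia.
  have xw : x < 1 - w.
    rewrite lt_neqAle; apply/andP; split; first by apply: contraNneq wA => <-.
    by rewrite (grid_subw l_gt0 l_lt_n wE); apply: le_trans x2 _; rewrite le_grid //;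
       clear - il; lia.
  split => //; apply/and3P; split; first by rewrite scan_lt_conf.
    by rewrite first_cell ?lexx // inn.
  apply/asboolP => t /andP[xt tx].
  have [tw|tw] := leP t (1 - w); last first.
    apply: (@leq_trans (window_sum l (conf S) (n - l))); last first.
      apply: win_le => //; apply/andP; split; first by rewrite ltn_subRL addnC.
      have : (n - l)%:R / n%:R < (i.+1 + l)%:R / n%:R :> R.
        rewrite -(grid_subw l_gt0 l_lt_n wE) -(grid_addw wE).
        by apply: lt_le_trans tw _; apply: le_trans tx _; rewrite lerD2r.
      by rewrite lt_grid // addSn ltnS.
    rewrite winE -(npts_window_grid A l_gt0 l_lt_n wE) -(grid_subw l_gt0 l_lt_n wE).
    apply: npts_le_in => y /supp /andP[_ y1] /andP[ty _].
    by rewrite subrK y1 (lt_trans tw ty).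
  have t0 : 0 < t by apply: lt_le_trans xt; apply: le_lt_trans x1; rewrite divr_ge0 ?ler0n.
  have [s /andP[s1 s2]] := exists_cell_gt n_pos t0.
  have st : s%:R / n%:R <= t <= s.+1%:R / n%:R by rewrite s2 ltW.
  have snl : (s < n - l)%N.
    by rewrite -(lt_grid (R := R) n_pos) -(grid_subw l_gt0 l_lt_n wE); apply: lt_le_trans tw.
  have is_ : (i < s.+1)%N.
    rewrite -(lt_grid (R := R) n_pos); apply: lt_le_trans s2; exact: lt_le_trans xt.
  have sil : (s < i.+1 + l)%N.
    rewrite -(lt_grid (R := R) n_pos) -(grid_addw wE).
    by apply: lt_le_trans s1 _; apply: le_trans tx _; rewrite lerD2r.
  have [si|si] := eqVneq s i.
    by rewrite first_cell ?inn // -si xt s2.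
  have far : cell_count n A s = 0%N \/ cell_count n A (s + l) = 0%N.
    by rewrite !cA; apply: conf_far.
  have [sl|sl] := eqVneq s (i + l)%N.
    have [p1 p2] := npts_window_split_le A wE st.
    rewrite (npts_window_split A l_gt0 l_lt_n wE st).
    rewrite sl cil cill in p1 p2 snl *; have := win_le (i + l)%N.
    rewrite winE window_sum_recl //; clear - p1 p2 snl l_gt0; lia.
  apply: leq_trans (npts_window_le l_gt0 l_lt_n wE st far) _.
  by rewrite -!winE geq_max; apply/andP; split; apply: win_le; clear - si sl snl is_ sil; lia.
Qed.

Lemma sum_over_cells (f : R -> nat) (F : nat -> nat) :
  (forall x i, x \in A -> i%:R / n%:R < x <= i.+1%:R / n%:R -> f x = F i) ->
  (\sum_(x <- A) f x = \sum_(i < n) conf S i * F i)%N.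
Proof.
move=> fF; transitivity (\sum_(x <- A) \sum_(i < n | (i%:R / n%:R < x <= i.+1%:R / n%:R)%R) F i)%N.
  apply: eq_big_seq => x xA; have /andP[x0 xle1] := supp xA.
  have [i xi] := exists_cell_gt n_pos x0.
  have i_lt_n : (i < n)%N.
    rewrite -(lt_grid (R := R) n_pos) (grid_one n_pos).
    by have /andP[h _] := xi; apply: lt_le_trans h xle1.
  rewrite (fF _ _ xA xi) (big_pred1 (Ordinal i_lt_n)) // => j.
  by rewrite (in_cell_eq _ xi).
rewrite (exchange_big_dep xpredT) //=; apply: eq_bigr => i _.
by rewrite -cA /cell_count npts_itvE big_const_seq iter_addn_0 mulnC.
Qed.

Lemma nu_confE : 1 - w \notin A ->
  nu w k A = (\sum_(i < n) conf S i * partner_tight n l k S i)%N.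
Proof.
move=> wA; rewrite /nu big_mkcond /=.
apply: (sum_over_cells (F := fun i => partner_tight n l k S i : nat)).
by move=> x i xA xi; rewrite -(nu_pointE xA wA xi); case: ifP.
Qed.

Lemma nu_tilde_confE :
  nu_tilde w k A = (\sum_(i < n) conf S i * doubling_raises n l k S i)%N.
Proof.
rewrite /nu_tilde; apply: (sum_over_cells (F := fun i => doubling_raises n l k S i : nat)).
by move=> x i xA xi; rewrite (nu_tilde_pointE xA xi).
Qed.
End Functionals.

End Configurations.

(** * Configurations with two coincidences *)

(** Containment of a multiset s of cells in a configuration. It has probability
    at most eps ^ size s, the form in which coincidences are estimated. *)
Definition covers (s : seq nat) (c : nat -> nat) : bool :=
  all (fun r => (count_mem r s <= c r)%N) s.

Lemma coversP (s : seq nat) (c : nat -> nat) :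
  reflect (forall r, (count_mem r s <= c r)%N) (covers s c).
Proof.
apply: (iffP allP) => [h r|h r _ //].
by have [/h //|/count_memPn ->] := boolP (r \in s).
Qed.

Definition close_pairs (n l : nat) : seq (seq nat) :=
  [seq [:: r; (r + o)%N] | r <- iota 0 n, o <- [:: 0; l; (l + l)]%N].

(** Two coincidences that share a cell: the two other points are at most 4l to
    the right of the leftmost one. *)
Definition close_triples (n l : nat) : seq (seq nat) :=
  let offsets := [:: 0; l; l + l; l + l + l; l + l + l + l]%N in
  [seq [:: r; (r + o.1)%N; (r + o.2)%N]
     | r <- iota 0 n, o <- [seq (a, b) | a <- offsets, b <- offsets]].

Definition clumps (n l : nat) : seq (seq nat) :=
  close_triples n l ++ [seq s ++ t | s <- close_pairs n l, t <- close_pairs n l].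

Definition clumped (n l : nat) (c : nat -> nat) : bool :=
  has (covers^~ c) (clumps n l).

Definition has_close_pair (n l : nat) (c : nat -> nat) : bool :=
  has (covers^~ c) (close_pairs n l).

Lemma mem_close_pairs (n l r o : nat) : (r < n)%N ->
  o \in [:: 0; l; l + l]%N -> [:: r; (r + o)%N] \in close_pairs n l.
Proof.
by move=> rn ol; apply/allpairsP; exists (r, o); rewrite mem_iota.
Qed.

Lemma mem_close_triples (n l r a b : nat) : (r < n)%N ->
  a \in [:: 0; l; l + l; l + l + l; l + l + l + l]%N ->
  b \in [:: 0; l; l + l; l + l + l; l + l + l + l]%N ->
  [:: r; (r + a)%N; (r + b)%N] \in close_triples n l.
Proof.
move=> rn al bl; apply/allpairsP; exists (r, (a, b)); split=> //; first by rewrite mem_iota.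
by apply/allpairsP; exists (a, b).
Qed.

(** The second coincidence survives the removal of a point from the cell
    r + o. It forms a triple with this point if it uses the point of the cell
    r, and otherwise the two coincidences have four different points. *)
Lemma two_close_pairs (n l r o r' o' : nat) (c : nat -> nat) :
  (r < n)%N -> (r' < n)%N ->
  o \in [:: 0; l; l + l]%N -> o' \in [:: 0; l; l + l]%N ->
  covers [:: r; r + o]%N c ->
  covers [:: r'; r' + o']%N (fun j => c j - (j == r + o))%N ->
  clumped n l c.
Proof.
move=> rn r'n ol o'l /coversP h /coversP h'.
have tri : covers [:: r'; r' + o'; r + o]%N c.
  apply/coversP => x; have := h x; have := h' x => /=.
  by rewrite (eq_sym (r + o)%N x); case: (x == _) => /=; clear; lia.
rewrite /clumped /clumps has_cat.
have [r'E|rr'] := eqVneq r' r.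
  apply/orP; left; apply/hasP; exists [:: r'; r' + o'; r + o]%N => //.
  by rewrite r'E; apply: mem_close_triples => //;
    rewrite !inE in ol o'l *; clear - ol o'l; lia.
have [rE|rr'o'] := eqVneq r (r' + o')%N.
  apply/orP; left; apply/hasP; exists [:: r'; r' + o'; r + o]%N => //.
  by rewrite rE -addnA; apply: mem_close_triples => //;
    rewrite !inE in ol o'l *; clear - ol o'l; lia.
apply/orP; right; apply/hasP; exists ([:: r; r + o] ++ [:: r'; r' + o'])%N.
  by apply/allpairsP; exists ([:: r; r + o]%N, [:: r'; r' + o']%N); split;
    rewrite ?mem_close_pairs.
apply/coversP => x; have := h x; have := coversP _ _ tri x => /=.
have [rx|rx] := eqVneq r x; last by clear; lia.
have -> : (r' == x) = false by rewrite -rx; apply/negbTE.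
have -> : (r' + o' == x)%N = false by rewrite -rx eq_sym; apply/negbTE.
by clear; lia.
Qed.

Definition occupied_cells (n : nat) (c : nat -> nat) : seq bool :=
  [seq c i != 0%N | i <- iota 0 n].

Lemma size_occupied_cells (n : nat) (c : nat -> nat) : size (occupied_cells n c) = n.
Proof. by rewrite size_map size_iota. Qed.

Section Isolated.
Variables (n l : nat) (c : nat -> nat).
Hypothesis c_ge : forall r, (n <= r)%N -> c r = 0%N.

Lemma nth_occupied_cells (r : nat) : nth false (occupied_cells n c) r = (c r != 0%N).
Proof.
have [rn|nr] := ltnP r n; first by rewrite (nth_map 0%N) ?size_iota // nth_iota.
by rewrite nth_default ?size_occupied_cells // c_ge.
Qed.

Hypothesis alone : ~~ has_close_pair n l c.

Let no_pair r o : o \in [:: 0; l; l + l]%N -> ~~ covers [:: r; (r + o)%N] c.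
Proof.
move=> ol; have [rn|nr] := ltnP r n.
  by have /hasPn := alone; apply; apply: mem_close_pairs.
by apply/coversP => /(_ r) /=; rewrite eqxx c_ge.
Qed.

Lemma alone_le1 (r : nat) : (c r <= 1)%N.
Proof.
rewrite leqNgt; apply: contra (no_pair r (o := 0%N) _) => [c2|]; last by rewrite inE eqxx.
by apply/coversP => x /=; rewrite !addn0; have [<-|_] := eqVneq r x.
Qed.

Lemma conf_occupied_cells : conf (occupied_cells n c) =1 c.
Proof. by move=> r; rewrite /conf nth_occupied_cells; have := alone_le1 r; case: (c r) => [|[]]. Qed.

Lemma sparse_occupied_cells : (0 < l)%N -> sparse l (occupied_cells n c).
Proof.
move=> l0; apply/sparseP => r; rewrite !nth_occupied_cells => cr.
suff h o : (0 < o)%N -> o \in [:: 0; l; l + l]%N -> (c (r + o)%N != 0%N) = false.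
  by rewrite -addnA !h ?inE ?eqxx ?orbT // addn_gt0 l0.
move=> o0 ol; apply: contraNF (no_pair r ol) => cro; apply/coversP => x /=.
have [<-|_] := eqVneq r x; first by rewrite -[X in _ == X]addn0 eqn_add2l gtn_eqF //= lt0n.
by have [<-|_] := eqVneq (r + o)%N x; rewrite //= lt0n.
Qed.
End Isolated.

(** If removing one point of a coincidence left a coincidence, the
    configuration would be clumped. *)
Lemma not_clumped_split (n l r o : nat) (c : nat -> nat) : (0 < l)%N ->
  (forall j, (n <= j)%N -> c j = 0%N) -> ~~ clumped n l c ->
  (r < n)%N -> o \in [:: 0; l; l + l]%N -> covers [:: r; r + o]%N c ->
  exists S, [/\ size S = n, sparse l S, nth false S r & c =1 add_at (conf S) (r + o)].
Proof.
move=> l0 c_ge nc rn ol cov.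
pose c' j := (c j - (j == r + o))%N.
have c'_ge j : (n <= j)%N -> c' j = 0%N by move=> jn; rewrite /c' c_ge.
have alone : ~~ has_close_pair n l c'.
  apply: contra nc => /hasP[_ /allpairsP[[r' o'] [/= r'n o'l ->]] cov'].
  apply: (two_close_pairs _ _ _ _ cov cov') => //.
  by move: r'n; rewrite mem_iota.
exists (occupied_cells n c'); split; rewrite ?size_occupied_cells ?sparse_occupied_cells //.
  rewrite nth_occupied_cells //; have := coversP _ _ cov r; rewrite /= eqxx /c' eq_sym.
  by case: eqP => _ /=; clear; lia.
move=> x; rewrite /add_at (conf_occupied_cells c'_ge alone) /c' subnK //.
have [->|//] := eqVneq x (r + o)%N.
by have := coversP _ _ cov (r + o)%N; rewrite /= eqxx; clear; lia.
Qed.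

(** The added point can be recognised: its cell is either the only one with two
    points, or the right one of the only two occupied cells at distance l. The
    latter uses that S has no two occupied cells at distance 2l. *)
Lemma add_at_inj (n l i i' : nat) (b b' : bool) (S S' : seq bool) : (0 < l)%N ->
  size S = n -> size S' = n -> sparse l S -> sparse l S' ->
  nth false S i -> nth false S' i' ->
  add_at (conf S) (i + b * l) =1 add_at (conf S') (i' + b' * l) ->
  [/\ S = S', i = i' & b = b'].
Proof.
move=> l0 sS sS' spS spS' Si Si' e.
have [Sil Sill] := sparseP _ _ spS _ Si.
have [Sil' Sill'] := sparseP _ _ spS' _ Si'.
have bnd (U : seq bool) x : (conf U x <= 1)%N by rewrite /conf; case: nth.
have cSi : conf S i = 1%N by rewrite /conf Si.
have cSi' : conf S' i' = 1%N by rewrite /conf Si'.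
have cSil : conf S (i + l) = 0%N by rewrite /conf Sil.
have cSil' : conf S' (i' + l) = 0%N by rewrite /conf Sil'.
have cSill' : conf S' (i' + l + l) = 0%N by rewrite /conf Sill'.
have key : (i + b * l = i' + b' * l)%N -> b = b' -> [/\ S = S', i = i' & b = b'].
  move=> e1 bb; split=> //; last first.
    by move: e1; rewrite bb => /addIn.
  apply: (@eq_from_nth _ false) => [|x _]; first by rewrite sS.
  have := e x; rewrite /add_at e1 => /addIn; rewrite /conf.
  by case: nth; case: nth.
have e1 := e i; have e2 := e (i + l)%N; have e3 := e i'; have e4 := e (i' + l)%N.
rewrite /add_at in e1 e2 e3 e4.
have far x : conf S x = 1%N -> conf S (x + l) = 0%N.
  by rewrite /conf; case: (boolP (nth false S x)) => // /(sparseP _ _ spS _)[-> _].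
have far' x : conf S' x = 1%N -> conf S' (x + l) = 0%N.
  by rewrite /conf; case: (boolP (nth false S' x)) => // /(sparseP _ _ spS' _)[-> _].
have b1 := bnd S i'; have b2 := bnd S (i' + l)%N; have b3 := bnd S' i; have b4 := bnd S' (i + l)%N.
have f1 := far i'; have f2 := far' i.
clear - key l0 cSi cSi' cSil cSil' cSill' e1 e2 e3 e4 b1 b2 b3 b4 f1 f2.
case: b b' key e1 e2 e3 e4 => -[] key; rewrite ?mul1n ?mul0n ?addn0 in key * => e1 e2 e3 e4.
- apply: key => //.
  apply/eqP; rewrite eqn_add2r; apply: contraT => ii.
  have iE : (i = i' + l)%N by lia.
  by rewrite -iE in cSill'; lia.
- have iE : i' = (i + l)%N by lia.
  by subst i'; lia.
- have iE : i = (i' + l)%N by lia.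
  by subst i; lia.
- apply: key => //; lia.
Qed.

Section Decomposition.
Context {R : realType}.
Variables (n l k : nat) (w : R) (A : {mset R}%mset).
Hypotheses (l_gt0 : (0 < l)%N) (l_lt_n : (l < n)%N) (wE : w = l%:R / n%:R).
Hypothesis k_gt0 : (0 < k)%N.
Hypothesis supp : forall x, x \in A -> 0 < x <= 1.

(** If there is no coincidence at distance 0 or l, the two scans agree on
    which side of k they are; otherwise one point of the coincidence can be
    removed. *)
Lemma scan_gap_configuration :
  (k <= scan w A)%N -> (discrete_scan n l A < k)%N ->
  ~~ clumped n l (cell_count n A) ->
  exists S i (b : bool), [/\ size S = n, sparse l S, nth false S i,
     (i + b * l < n)%N & cell_count n A =1 add_at (conf S) (i + b * l)].
Proof.
move=> kA kD nc; pose c := cell_count n A.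
have c_ge j : (n <= j)%N -> c j = 0%N.
  by apply: (cell_count_ge _ supp); apply: leq_ltn_trans l_lt_n.
have [/existsP[[i /= i_lt] /existsP[b cov]]|none] :=
  boolP [exists i : 'I_n, exists b : bool, covers [:: (i : nat); (i + b * l)%N] c].
  have bl : (b * l)%N \in [:: 0; l; l + l]%N by case: b {cov}; rewrite ?mul1n !inE eqxx ?orbT.
  have [S [sS spS Si cS]] := not_clumped_split l_gt0 c_ge nc i_lt bl cov.
  exists S, i, b; split => //; rewrite ltnNge; apply/negP => /c_ge.
  by rewrite cS /add_at eqxx addn1.
have none' r (b : bool) : ~~ covers [:: r; r + b * l]%N c.
  have [rn|nr] := ltnP r n.
    by apply: contra none => cov; apply/existsP; exists (Ordinal rn); apply/existsP; exists b.
  by apply/coversP => /(_ r) /=; rewrite eqxx c_ge.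
have c1 r : (c r <= 1)%N.
  rewrite leqNgt; apply: contra (none' r false) => c2; apply/coversP => x /=.
  by rewrite !addn0; have [<-|_] := eqVneq r x.
have far s : c s = 0%N \/ c (s + l)%N = 0%N.
  case cs: (c s) => [|m]; [by left | right]; apply/eqP; apply: contraT => csl.
  have := none' s true; rewrite mul1n => /coversP[] x /=.
  have [<-|_] := eqVneq s x; first by rewrite -[X in _ == X]addn0 eqn_add2l gtn_eqF //= cs.
  by have [<-|_] := eqVneq (s + l)%N x; rewrite //= lt0n.
move: kD kA; rewrite (discrete_scan_ltE A l_gt0 l_lt_n) // leqNgt.
rewrite (scan_ltE l_gt0 l_lt_n wE supp _ far) -/c => + /negP[].
by rewrite (eq_windows_below _ _ _ (c' := c)) // => r; have := c1 r; case: (c r) => [|[]].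
Qed.
End Decomposition.

(** * Poisson probabilities and finite unions *)

Section PoissonLaw.
Context {R : realType}.
Implicit Type r : R.

(** With 0 ^ 0 = 1, rate 0 gives the Dirac mass at 0, in agreement with
    poisson_prob. *)
Definition poisson_mass r (j : nat) : R := r ^+ j / j`!%:R * expR (- r).

Lemma poisson_prob_set1 r (j : nat) : 0 <= r ->
  poisson_prob r 0%N [set j] = (poisson_mass r j)%:E.
Proof.
rewrite le_eqVlt => /predU1P[<-|r0].
  rewrite /poisson_prob ltxx diracE /poisson_mass oppr0 expR0 mulr1 expr0n.
  case: j => [|j]; first by rewrite mem_set //= fact0 divr1.
  by rewrite memNset //= mul0r.
rewrite /poisson_prob r0 esum_set1 ?lee_fin ?poisson_pmf_ge0 //.
by rewrite /poisson_pmf r0.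
Qed.

(** Since (j + m)! >= j!, the tail from m on is at most r ^ m times the total
    mass. *)
Lemma poisson_prob_ge r (m : nat) : 0 <= r ->
  (poisson_prob r 0%N [set j | (m <= j)%N] <= (r ^+ m)%:E)%E.
Proof.
rewrite le_eqVlt => /predU1P[<-|r0].
  rewrite /poisson_prob ltxx diracE expr0n.
  by case: m => [|m]; [rewrite mem_set | rewrite memNset].
have -> : [set j | (m <= j)%N] = (fun j => (j + m)%N) @` [set: nat].
  apply/seteqP; split => j /=; last by move=> [i _ <-]; rewrite leq_addl.
  by move=> mj; exists (j - m)%N => //; rewrite subnK.
have pT : poisson_prob r 0%N [set: nat] = 1%E by rewrite probability_setT.
rewrite -[leRHS]mule1 -pT /poisson_prob r0 esum_image; last first.
  by move=> i j _ _ /= /addIn.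
apply: (@le_trans _ _ (\esum_(i in [set: nat]) ((r ^+ m)%:E * (poisson_pmf r i)%:E))%E).
  apply: le_esum => i _; rewrite -EFinM lee_fin /poisson_pmf r0 exprD.
  rewrite mulrA ler_pM2r ?expR_gt0 // [_ * r ^+ m]mulrC -mulrA.
  rewrite ler_pM2l ?exprn_gt0 // ler_pM2l ?exprn_gt0 //.
  by rewrite lef_pV2 ?posrE ?ltr0n ?fact_gt0 // ler_nat leq_fact // leq_addr.
rewrite -!nneseries_esumT; last 2 first.
- by move=> i; rewrite lee_fin poisson_pmf_ge0.
- by move=> i; rewrite -EFinM lee_fin mulr_ge0 ?poisson_pmf_ge0 ?exprn_ge0 // ltW.
by rewrite nneseriesZl // => i _; rewrite lee_fin poisson_pmf_ge0.
Qed.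
End PoissonLaw.

Section FiniteUnions.
Context {R : realType} {d : measure_display} {T : measurableType d}.
Variable P : probability T R.

Definition prob (A : set T) : R := fine (P A).

Lemma probE (A : set T) : measurable A -> P A = (prob A)%:E.
Proof. by move=> mA; rewrite /prob fineK // fin_num_measure. Qed.

Lemma prob_ge0 (A : set T) : 0 <= prob A.
Proof. by rewrite fine_ge0. Qed.

Lemma prob_le (A B : set T) : measurable A -> measurable B -> A `<=` B -> prob A <= prob B.
Proof. by move=> mA mB AB; rewrite -lee_fin -!probE //; apply: le_measure; rewrite ?inE. Qed.

Lemma prob_union_le (A B : set T) : measurable A -> measurable B ->
  prob (A `|` B) <= prob A + prob B.
Proof.
move=> mA mB; rewrite -lee_fin EFinD -!probE //; last exact: measurableU.
exact: measureU2.
Qed.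

Lemma prob_disjoint_union (A B : set T) : measurable A -> measurable B ->
  A `&` B = set0 -> prob (A `|` B) = prob A + prob B.
Proof.
move=> mA mB AB; apply: EFin_inj; rewrite EFinD -!probE //; last exact: measurableU.
exact: measureU.
Qed.

Lemma measurable_exists_seq (I : eqType) (L : seq I) (F : I -> set T) :
  (forall i, measurable (F i)) -> measurable [set o | exists2 i, i \in L & F i o].
Proof.
move=> mF; elim: L => [|x L IH].
  by rewrite (_ : [set _ | _] = set0) //; apply/seteqP; split => o //= [].
rewrite (_ : [set _ | _] = F x `|` [set o | exists2 i, i \in L & F i o]).
  exact: measurableU.
apply/seteqP; split => o /=.
  by move=> [i]; rewrite inE => /predU1P[->|iL] Fi; [left | right; exists i].
move=> [Fx|[i iL Fi]]; first by exists x; rewrite // mem_head.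
by exists i; rewrite // inE iL orbT.
Qed.

Lemma prob_le_sum (I : eqType) (L : seq I) (F : I -> set T) (D : set T) :
  measurable D -> (forall i, measurable (F i)) ->
  (forall o, D o -> exists2 i, i \in L & F i o) ->
  prob D <= \sum_(i <- L) prob (F i).
Proof.
move=> mD mF; elim: L D mD => [|x L IH] D mD DF.
  rewrite big_nil (_ : D = set0) ?/prob ?measure0 //.
  by apply/seteqP; split => o // /DF[].
have mDx : measurable (D `\` F x) by apply: measurableD.
rewrite big_cons; apply: (@le_trans _ _ (prob (F x `|` (D `\` F x)))).
  apply: prob_le => //; first exact: measurableU.
  by move=> o Do; have [Fx|Fx] := pselect (F x o); [left | right].
apply: le_trans (prob_union_le _ _) _ => //; rewrite lerD2l; apply: IH => // o [Do nF].
by have [i] := DF o Do; rewrite inE => /predU1P[-> //|iL Fi]; exists i.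
Qed.

Lemma prob_sum_le (I : eqType) (L : seq I) (F : I -> set T) (D : set T) :
  measurable D -> uniq L -> (forall i, measurable (F i)) ->
  (forall i, i \in L -> F i `<=` D) ->
  (forall i j o, i \in L -> j \in L -> F i o -> F j o -> i = j) ->
  \sum_(i <- L) prob (F i) <= prob D.
Proof.
move=> mD uL mF; elim: L D mD uL => [|x L IH] D mD /=; first by rewrite big_nil prob_ge0.
move=> /andP[xL uL] FD tF; rewrite big_cons.
have mDx : measurable (D `\` F x) by apply: measurableD.
have -> : D = F x `|` (D `\` F x).
  apply/seteqP; split => o; last by move=> [/(FD _ (mem_head _ _))|[]].
  by move=> Do; have [Fx|Fx] := pselect (F x o); [left | right].
rewrite prob_disjoint_union //; last first.
  by apply/seteqP; split => o // [Fx [_]].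
rewrite lerD2l; apply: IH => // [i iL o Fi|i j o iL jL].
  split; first by apply: (FD i) => //; rewrite inE iL orbT.
  move=> Fx; move: xL; rewrite (tF x i o) ?iL ?mem_head //.
  by rewrite inE iL orbT.
by apply: tF; rewrite inE ?iL ?jL orbT.
Qed.
End FiniteUnions.

(** * The law of the cell counts *)

Section PoissonCells.
Context {R : realType} {d : measure_display} {T : measurableType d}.
Variables (P : probability T R) (lambda : R) (Pi : T -> {mset R}%mset).
Hypothesis lambda_gt0 : 0 < lambda.
Hypothesis hPi : homogeneous_poisson_process P lambda Pi.
Variable n : nat.
Hypothesis n_pos : (0 < n)%N.

Let eps : R := lambda / n%:R.

Let eps_ge0 : 0 <= eps.
Proof. by rewrite divr_ge0 ?ler0n // ltW. Qed.

Definition cell (m r : nat) : set R := `]r%:R / m%:R, r.+1%:R / m%:R].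

Lemma measurable_cell (m r : nat) : measurable (cell m r).
Proof. exact: measurable_itv. Qed.

Lemma cell_sub01 (m r : nat) : (r < m)%N -> cell m r `<=` `]0, 1].
Proof.
move=> rm x; rewrite /cell /= !in_itv /= => /andP[x1 x2].
have m0 : (0 < m)%N by apply: leq_ltn_trans rm.
apply/andP; split; first by apply: le_lt_trans x1; rewrite divr_ge0 ?ler0n.
by apply: le_trans x2 _; rewrite ler_pdivrMr ?ltr0n // mul1r ler_nat.
Qed.

Lemma measure_cell (m r : nat) : (0 < m)%N ->
  lebesgue_measure (cell m r) = (m%:R^-1)%:E.
Proof.
move=> m0; rewrite lebesgue_measure_itv /= lte_fin ltr_pM2r ?invr_gt0 ?ltr0n //.
by rewrite ltr_nat leqnn -EFinB -mulrBl -natrB // subSnn mul1r.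
Qed.

Lemma measurable_npts (B : set R) (U : set nat) : measurable B -> B `<=` `]0, 1] ->
  measurable [set o | U (npts (Pi o) B)].
Proof.
by move=> mB sB; have := hpp_measurable hPi mB sB measurableT (Y := U);
  rewrite setTI; apply.
Qed.

Lemma measurable_npts_oc (a b : R) (U : set nat) : 0 <= a -> b <= 1 ->
  measurable [set o | U (npts_oc (Pi o) a b)].
Proof.
move=> a0 b1; apply: measurable_npts => [|x]; first exact: measurable_itv.
by rewrite /= !in_itv /= => /andP[ax xb]; rewrite (le_lt_trans a0 ax) (le_trans xb b1).
Qed.

Lemma measurable_cell_count (m r : nat) (U : set nat) :
  measurable [set o | U (cell_count m (Pi o) r)].
Proof.
have [rm|mr] := ltnP r m.
  by apply: measurable_npts; [exact: measurable_cell | exact: cell_sub01].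
have [->|m0] := eqVneq m 0%N.
  rewrite (_ : [set _ | _] = if `[< U 0%N >] then setT else set0).
    by case: ifP.
  have z A : cell_count (R := R) 0 A r = 0%N.
    by apply: npts_eq0 => x _; rewrite !invr0 !mulr0; apply/negP; lra.
  apply/seteqP; split => o /=; first by rewrite z => /asboolP ->.
  by case: asboolP => // h _; rewrite z.
have z o : cell_count m (Pi o) r = 0%N.
  by apply: (cell_count_ge _ _ mr) => [|x]; rewrite ?lt0n //; apply: (hpp_support hPi).
rewrite (_ : [set _ | _] = if `[< U 0%N >] then setT else set0).
  by case: ifP.
apply/seteqP; split => o /=; first by rewrite z => /asboolP ->.
by case: asboolP => // h _; rewrite z.
Qed.

Lemma cell_index_eq (r r' : nat) (x : R) : cell n r x -> cell n r' x -> r = r'.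
Proof.
rewrite /cell /= !in_itv /= => /andP[a b] /andP[a' b'].
have := lt_le_trans a b'; have := lt_le_trans a' b; rewrite !lt_grid // !ltnS => h1 h2.
by apply/eqP; rewrite eqn_leq h1 h2.
Qed.

Lemma npts_setD (A : {mset R}%mset) (B D : set R) : D `<=` B ->
  npts A B = (npts A D + npts A (B `\` D))%N.
Proof.
move=> DB; rewrite /npts -count_predUI [X in (_ + X)%N](_ : _ = 0%N).
  rewrite addn0; apply: eq_count => x /=; apply/idP/orP.
    move=> /set_mem Bx; have [Dx|Dx] := pselect (D x); [left|right]; exact/mem_set.
  by move=> [/set_mem/DB h|/set_mem[h _]]; apply/mem_set.
apply/eqP; rewrite -leqn0 leqNgt -has_count; apply/hasPn => x _ /=.
by apply/negP => /andP[/set_mem Dx /set_mem[_]].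
Qed.

Lemma npts0 (A : {mset R}%mset) : npts A set0 = 0%N.
Proof. by apply/eqP; rewrite -leqn0 leqNgt -has_count; apply/hasPn => x _; rewrite in_set0. Qed.

(** The sets D j and their complements in the cells are 2n disjoint sets, to
    which the independence of counts applies. *)
Lemma prob_split_cells (D : 'I_n -> set R) (u v : 'I_n -> nat) (s : 'I_n -> R) :
  (forall j, measurable (D j)) -> (forall j, D j `<=` cell n j) ->
  (forall j, lebesgue_measure (D j) = (s j)%:E) ->
  prob P [set o | forall j, npts (Pi o) (D j) = u j /\
                        npts (Pi o) (cell n j) = (u j + v j)%N] =
  \prod_(j < n) (poisson_mass (lambda * s j) (u j) *
                 poisson_mass (eps - lambda * s j) (v j)).
Proof.
move=> mD DC sD.
pose B (x : 'I_(n + n)) := match fintype.split x with inl j => D j | inr j => cell n j `\` D j end.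
pose U (x : 'I_(n + n)) : set nat := match fintype.split x with inl j => [set u j] | inr j => [set v j] end.
have mB x : measurable (B x).
  by rewrite /B; case: fintype.split => j //; apply: measurableD => //; apply: measurable_cell.
have BC x : B x `<=` cell n (match fintype.split x with inl j => j | inr j => j end).
  by rewrite /B; case: fintype.split => j // y [].
have B01 x : B x `<=` `]0, 1].
  by apply: subset_trans (BC x) _; apply: cell_sub01; case: fintype.split => j; apply: ltn_ord.
have tB : trivIset setT B.
  move=> x y _ _ [z [Bx By]]; have := cell_index_eq (BC _ _ Bx) (BC _ _ By).
  move: Bx By; rewrite /B -[x]splitK -[y]splitK !unsplitK.
  case: (fintype.split x) (fintype.split y) => j [] j' /= Bj Bj' /ord_inj jj'; subst j' => //.
    by case: Bj'.
  by case: Bj.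
have s_ge0 j : 0 <= s j by rewrite -lee_fin -sD.
have s_le j : s j <= n%:R^-1.
  rewrite -lee_fin -sD -(measure_cell j n_pos); apply: le_measure; rewrite ?inE //.
  - exact: (mD j).
  exact: (measurable_cell n j).
have eD (j : 'I_n) : lebesgue_measure (cell n j `\` D j) = (n%:R^-1 - s j)%:E.
  have fin : (lebesgue_measure (cell n j) < +oo)%E by rewrite measure_cell // ltry.
  have -> := @measureD _ _ _ (@lebesgue_measure R) _ _ (measurable_cell n j) (mD j) fin.
  by rewrite (setIidr (@DC j)) EFinB -sD -(measure_cell j n_pos).
have := hpp_indep hPi mB B01 tB U.
rewrite (_ : [set o | forall i, U i (npts (Pi o) (B i))] =
  [set o | forall j, npts (Pi o) (D j) = u j /\
                        npts (Pi o) (cell n j) = (u j + v j)%N]); last first.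
  apply/seteqP; split => o /= h.
    move=> j; have := h (lshift n j); have := h (rshift n j).
    rewrite /U /B (unsplitK (inl j)) (unsplitK (inr j)) /= => h1 h2.
    by rewrite (npts_setD _ (DC j)) h1 h2.
  move=> x; rewrite /U /B; case: (fintype.split x) => j /=; have [h1 h2] := h j => //.
  by move: h2; rewrite (npts_setD _ (DC j)) h1 => /addnI.
move=> h; rewrite /prob h; apply: EFin_inj; rewrite fineK; last first.
  by apply/prode_fin_num => x _; rewrite (hpp_law hPi (mB x) (B01 x)) fin_num_measure.
rewrite big_split_ord /= -big_split /= -prodEFin; apply: eq_bigr => j _.
rewrite !(hpp_law hPi) // /U /B (unsplitK (inl j)) (unsplitK (inr j)) /=.
rewrite sD eD /= mulrBr !poisson_prob_set1 ?mulr_ge0 ?(ltW lambda_gt0) //.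
by rewrite -mulrBr mulr_ge0 ?(ltW lambda_gt0) // subr_ge0.
Qed.

End PoissonCells.

Section CellConfigurations.
Context {R : realType} {d : measure_display} {T : measurableType d}.
Variables (P : probability T R) (lambda : R) (Pi : T -> {mset R}%mset).
Hypothesis lambda_gt0 : 0 < lambda.
Hypothesis hPi : homogeneous_poisson_process P lambda Pi.
Variable n : nat.
Hypothesis n_pos : (0 < n)%N.

Let eps : R := lambda / n%:R.

Let eps_ge0 : 0 <= eps.
Proof. by rewrite divr_ge0 ?ler0n // ltW. Qed.

Lemma cell_count_beyond (o : T) (r : nat) : (n <= r)%N -> cell_count n (Pi o) r = 0%N.
Proof. by apply: (cell_count_ge n_pos) => x; apply: (hpp_support hPi). Qed.

Definition count_event (c : nat -> nat) : set T :=
  [set o | cell_count n (Pi o) =1 c].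

Lemma count_event_ord (c : nat -> nat) : (forall r, (n <= r)%N -> c r = 0%N) ->
  count_event c = [set o | forall j : 'I_n, cell_count n (Pi o) j = c j].
Proof.
move=> c0; apply/seteqP; split => o /= h; first by move=> j; apply: h.
move=> r; have [rn|nr] := ltnP r n; first exact: (h (Ordinal rn)).
by rewrite c0 // cell_count_beyond.
Qed.

Lemma measurable_count_event (c : nat -> nat) : measurable (count_event c).
Proof.
rewrite (_ : count_event c = \bigcap_r [set o | [set c r] (cell_count n (Pi o) r)]).
  by apply: bigcapT_measurable => r; apply: (measurable_cell_count hPi).
by apply/seteqP; split => o h r; [move=> _; apply: h | apply: (h r I)].
Qed.

Lemma poisson_mass00 : poisson_mass (lambda * 0) 0 = 1 :> R.
Proof. by rewrite /poisson_mass mulr0 expr0 oppr0 expR0 fact0 divr1 mulr1. Qed.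

Lemma prob_count_event (c : nat -> nat) : (forall r, (n <= r)%N -> c r = 0%N) ->
  prob P (count_event c) = \prod_(j < n) poisson_mass eps (c j).
Proof.
move=> c0; rewrite count_event_ord //.
have := @prob_split_cells _ _ _ P lambda Pi lambda_gt0 hPi n n_pos (fun=> set0)
  (fun=> 0%N) (fun j => c j) (fun=> 0) (fun=> measurable0) (fun _ => @sub0set _ _)
  (fun=> measure0 _).
rewrite (_ : [set o | _] = [set o | forall j : 'I_n, cell_count n (Pi o) j = c j]); last first.
  apply/seteqP; split => o /= h j; first by have [_ e] := h j; rewrite -[RHS]add0n -e.
  by rewrite npts0 add0n; split => //; apply: h.
by move=> ->; apply: eq_bigr => j _; rewrite poisson_mass00 mul1r mulr0 subr0.
Qed.

(** Only the factor of the cell j changes, and the Poisson masses at m + 1 and m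
    have ratio eps / (m + 1). *)
Lemma prob_count_event_add (c : nat -> nat) (j : nat) :
  (forall r, (n <= r)%N -> c r = 0%N) -> (j < n)%N ->
  prob P (count_event (add_at c j)) = eps / (c j).+1%:R * prob P (count_event c).
Proof.
move=> c0 jn; have a0 r : (n <= r)%N -> add_at c j r = 0%N.
  by move=> nr; rewrite /add_at c0 // gtn_eqF // (leq_trans jn nr).
rewrite !prob_count_event // (bigD1 (Ordinal jn)) //= [in RHS](bigD1 (Ordinal jn)) //= mulrA.
congr (_ * _).
  rewrite /add_at eqxx addn1 /poisson_mass factS natrM exprS.
  have f0 : ((c j)`!%:R : R) != 0 by rewrite pnatr_eq0 -lt0n fact_gt0.
  have s0 : ((c j).+1%:R : R) != 0 by rewrite pnatr_eq0.
  move: ((c j)`!%:R) ((c j).+1%:R) f0 s0 => f m f0 m0.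
  by field; rewrite f0 m0.
apply: eq_bigr => i; rewrite -val_eqE /= => /negbTE ij.
by rewrite /add_at ij addn0.
Qed.

(** On the grid of mesh 1/(nH), the cell i * H + a is the a-th of the H equal
    parts of the cell i. *)
Definition fine_pair_event (H i j a b : nat) : set T :=
  [set o | cell_count (n * H) (Pi o) (i * H + a) = 1%N /\
           cell_count (n * H) (Pi o) (j * H + b) = 1%N].

Lemma measurable_fine_pair_event (H i j a b : nat) :
  measurable (fine_pair_event H i j a b).
Proof.
rewrite (_ : fine_pair_event _ _ _ _ _ =
  [set o | [set 1%N] (cell_count (n * H) (Pi o) (i * H + a))] `&`
  [set o | [set 1%N] (cell_count (n * H) (Pi o) (j * H + b))]) //.
by apply: measurableI; apply: (measurable_cell_count hPi).
Qed.

Lemma fine_cell_sub (H i a : nat) : (a < H)%N -> cell (R := R) (n * H) (i * H + a) `<=` cell n i.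
Proof.
move=> aH x; have H0 : (0 < H)%N by apply: leq_ltn_trans aH.
have nH0 : (0 < n * H)%N by rewrite muln_gt0 n_pos.
have gridH := fun j : nat => @grid_refine R n H j H0.
rewrite /cell /= !in_itv /= => /andP[x1 x2]; apply/andP; split.
  by apply: le_lt_trans x1; rewrite gridH le_grid // leq_addr.
by apply: le_trans x2 _; rewrite gridH le_grid // mulSn -addnS addnC leq_add2r.
Qed.

(** A single point of a cell is in each of the H equal parts with the same
    probability, and independently for two cells. *)
Lemma prob_fine_pair (c : nat -> nat) (H i j a b : nat) :
  (forall r, (n <= r)%N -> c r = 0%N) ->
  (i < n)%N -> (j < n)%N -> i <> j -> c i = 1%N -> c j = 1%N ->
  (a < H)%N -> (b < H)%N ->
  prob P (count_event c `&` fine_pair_event H i j a b) = prob P (count_event c) / H%:R ^+ 2.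
Proof.
move=> c0 i_n j_n ij ci cj aH bH.
have H0 : (0 < H)%N by apply: leq_ltn_trans aH.
have HR : H%:R != 0 :> R by rewrite pnatr_eq0 -lt0n.
have nR : n%:R != 0 :> R by rewrite pnatr_eq0 -lt0n.
pose D (x : 'I_n) : set R := if x == i :> nat then cell (n * H) (i * H + a)
  else if x == j :> nat then cell (n * H) (j * H + b) else set0.
pose u (x : 'I_n) : nat := ((x == i :> nat) || (x == j :> nat)).
pose s (x : 'I_n) : R := if u x == 1%N then (n * H)%:R^-1 else 0.
have mD x : measurable (D x).
  by rewrite /D; case: ifP => _; [|case: ifP => _ //]; apply: measurable_cell.
have DC x : D x `<=` cell n x.
  rewrite /D; case: eqP => [->|_]; first exact: fine_cell_sub.
  by case: eqP => [->|_]; [exact: fine_cell_sub | exact: sub0set].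
have sD x : lebesgue_measure (D x) = (s x)%:E.
  rewrite /D /s /u; case: eqP => _ /=; first by rewrite measure_cell // muln_gt0 n_pos.
  by case: eqP => _ /=; rewrite ?measure0 ?measure_cell // muln_gt0 n_pos.
have uc (x : 'I_n) : (u x <= c x)%N.
  by rewrite /u; case: eqP => [->|_] /=; rewrite ?ci //; case: eqP => [->|_] //; rewrite cj.
rewrite count_event_ord //.
have := @prob_split_cells _ _ _ P lambda Pi lambda_gt0 hPi n n_pos D u
  (fun x => c x - u x)%N s mD DC sD.
rewrite (_ : [set o | _] = [set o | forall j : 'I_n, cell_count n (Pi o) j = c j]
    `&` fine_pair_event H i j a b); last first.
  apply/seteqP; split => o /=.
    move=> h; split; first by move=> x; have [_ e] := h x; rewrite -[RHS](subnKC (uc x)) -e.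
    split; [have [+ _] := h (Ordinal i_n)|have [+ _] := h (Ordinal j_n)].
      by rewrite /D /u /= eqxx.
    by rewrite /D /u /= eqxx orbT; case: eqP => [ji|_]; first by case: ij.
  move=> [h [hi hj]] x; rewrite subnKC //; split; last exact: h.
  rewrite /D /u; case: eqP => _ //=; case: eqP => _ //; exact: npts0.
move=> ->; rewrite -count_event_ord // prob_count_event //.
pose g (x : 'I_n) : R := if u x == 1%N then H%:R^-1 else 1.
transitivity (\prod_(x < n) (poisson_mass eps (c x) * g x)).
  apply: eq_bigr => x _; rewrite /s /g; case: (eqVneq (u x) 1%N) => ux; last first.
    have -> : u x = 0%N by move: ux; rewrite /u; case: (_ || _).
    by rewrite poisson_mass00 mul1r mulr0 subr0 subn0 mulr1.
  have cx : c x = 1%N.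
    by move: ux; rewrite /u; case: eqP => [->|_] //=; case: eqP => [->|].
  rewrite ux cx subnn /poisson_mass !expr1 expr0 fact0 (_ : 1`! = 1%N) // !divr1 !mul1r.
  rewrite -mulrA -expRD -opprD subrKC [RHS]mulrAC; congr (_ * _).
  by rewrite /eps natrM; field; rewrite HR nR.
rewrite big_split /=; congr (_ * _).
rewrite (bigD1 (Ordinal i_n)) //= (bigD1 (Ordinal j_n)) /=; last first.
  by rewrite -val_eqE /=; apply/eqP => /esym.
rewrite /g /u /= !eqxx !orbT big1 ?mulr1 ?expr2 ?invfM // => x.
by rewrite -!val_eqE /= => /andP[/negbTE-> /negbTE->].
Qed.

Lemma measurable_covers (s : seq nat) :
  measurable [set o | covers s (cell_count n (Pi o))].
Proof.
rewrite (_ : [set o | _] =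
  \bigcap_r [set o | [set m | (count_mem r s <= m)%N] (cell_count n (Pi o) r)]).
  by apply: bigcapT_measurable => r; apply: (measurable_cell_count hPi).
by apply/seteqP; split => o h; [move=> r _; apply: (coversP _ _ h)|
  apply/coversP => r; apply: (h r I)].
Qed.

(** The counts of the cells are independent, and each is estimated by
    [poisson_prob_ge]. *)
Lemma prob_covers (s : seq nat) :
  prob P [set o | covers s (cell_count n (Pi o))] <= eps ^+ size s.
Proof.
have [/hasP[r rs nr]|] := boolP (has (fun r => n <= r)%N s).
  rewrite (_ : [set o | _] = set0) ?/prob ?measure0 ?exprn_ge0 //.
  apply/seteqP; split => o //= /coversP /(_ r).
  by rewrite cell_count_beyond // leqn0 -leqn0 leqNgt -has_count => /hasP[]; exists r => //=.
move=> /hasPn s_n.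
have sz : size s = (\sum_(j < n) count_mem (j : nat) s)%N.
  rewrite -sum1_size (eq_big_seq (fun r => \sum_(j < n) (r == j :> nat))%N).
    rewrite exchange_big /=; apply: eq_bigr => j _.
    rewrite -sum1_count [RHS]big_mkcond /=; apply: eq_bigr => r _; by case: eqP.
  move=> r /s_n; rewrite -ltnNge => rn; rewrite (bigD1 (Ordinal rn)) //= eqxx big1 //.
  by move=> i; rewrite -val_eqE /= eq_sym => /negbTE ->.
rewrite sz expr_sum.
have tB : trivIset [set: 'I_n] (fun j => cell (R := R) n j).
  by move=> i j _ _ [x [xi xj]]; apply: ord_inj; apply: cell_index_eq xi xj.
have mB (i : 'I_n) : measurable (cell (R := R) n i) by apply: measurable_cell.
have sB (i : 'I_n) : cell (R := R) n i `<=` `]0, 1] by apply: cell_sub01.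
have h := hpp_indep hPi mB sB tB (fun j : 'I_n => [set m | (count_mem (j : nat) s <= m)%N]).
have mE (i : 'I_n) := measurable_npts hPi [set m | (count_mem (i : nat) s <= m)%N]
  (mB i) (sB i).
rewrite -lee_fin -probE; last exact: measurable_covers.
rewrite (_ : [set o | _] = [set o | forall i : 'I_n, (count_mem (i : nat) s <= npts (Pi o) (cell n i))%N]).
  rewrite [leLHS]h (eq_bigr (fun i : 'I_n => (prob P [set o | [set m | (count_mem (i : nat) s <= m)%N]
    (npts (Pi o) (cell n i))])%:E)); last first.
    by move=> i _; rewrite probE.
  rewrite prodEFin lee_fin; apply: ler_prod => i _; rewrite prob_ge0 /= -lee_fin -probE; last exact: mE.
  have := hpp_law hPi (mB i) (sB i) [set m | (count_mem (i : nat) s <= m)%N].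
  rewrite measure_cell //= => ->; exact: poisson_prob_ge.
apply/seteqP; split => o /= ho; first by move=> j; apply: (coversP _ _ ho).
apply/allP => r rs; have := s_n r rs; rewrite -ltnNge => rn; exact: (ho (Ordinal rn)).
Qed.

End CellConfigurations.

(** * The gap event on one configuration *)

(** The room in which t can be moved to the right before a point leaves the
    window (t, t + w]. *)
Lemma gap_above {R : realType} (s : seq R) (t b : R) : t < b ->
  exists2 u, t < u < b & forall x, x \in s -> t < x -> u < x.
Proof.
move=> tb; elim: s => [|x s [u /andP[tu ub] us]].
  by exists ((t + b) / 2); rewrite ?midf_lt.
have [tx|xt] := ltP t x; last first.
  exists u; first by rewrite tu.
  move=> y; rewrite inE => /predU1P[->|/us//] /lt_le_trans /(_ xt).
  by rewrite ltxx.
exists (Num.min u ((t + x) / 2)).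
  by rewrite lt_min tu midf_lt //= gt_min ub.
move=> y; rewrite inE => /predU1P[-> _|/us h /h uy].
  by rewrite gt_min [X in _ || X]midf_lt // orbT.
by rewrite gt_min uy.
Qed.

Lemma fine_cell_unique {R : realType} (n H i a a' : nat) (A : {mset R}%mset) :
  (0 < n)%N -> (a < H)%N -> (a' < H)%N -> cell_count n A i = 1%N ->
  cell_count (n * H) A (i * H + a) = 1%N ->
  cell_count (n * H) A (i * H + a') = 1%N -> a = a'.
Proof.
move=> n_pos aH a'H; have H0 : (0 < H)%N by apply: leq_ltn_trans aH.
have nH0 : (0 < n * H)%N by rewrite muln_gt0 n_pos.
have gridH := fun j : nat => @grid_refine R n H j H0.
rewrite {1}/cell_count !gridH npts_grid ?leq_mul2r ?leqnSn ?orbT // mulSn.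
rewrite -{1}[(i * H)%N]add0n big_addn addnK big_mkord [in X in _ -> X](addnC _ a) [in X in _ -> X](addnC _ a').
rewrite (bigD1 (Ordinal aH)) //= addnC => + ha ha'; rewrite ha.
apply: contra_eq => aa'; rewrite (bigD1 (Ordinal a'H)) /= 1?addnC ?ha' //.
by rewrite -val_eqE /= eq_sym.
Qed.

Lemma double_sum_ord (H : nat) : ((\sum_(a < H) a).*2 + H = H * H)%N.
Proof.
elim: H => [|H IH]; first by rewrite big_ord0.
rewrite big_ord_recr /= mulSn mulnS -IH; move: (\sum_(a < H) a)%N => s; lia. Qed.

Lemma card_lt_pairs (H : nat) :
  (#|[pred x : 'I_H * 'I_H | (x.2 < x.1)%N]|.*2 + H = H * H)%N.
Proof.
rewrite -double_sum_ord; congr (_.*2 + _)%N.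
rewrite -sum1_card -(pair_big_dep xpredT (fun a b : 'I_H => b < a)%N (fun _ _ => 1%N)) /=.
apply: eq_bigr => a _; rewrite sum1_card -[RHS]card_ord.
have inj : injective (widen_ord (ltnW (ltn_ord a))).
  by move=> x y /(congr1 val) /= /ord_inj.
rewrite -(fintype.card_image inj).
apply: eq_card => b; apply/idP/fintype.imageP => [ba|[x _ ->]]; last exact: (ltn_ord x).
by exists (Ordinal (ba : (b < a)%N)) => //; apply: ord_inj.
Qed.

Lemma card_le_pairs (H : nat) :
  (#|[pred x : 'I_H * 'I_H | (x.2 <= x.1)%N]|.*2 = H * H + H)%N.
Proof.
have swapE : #|[pred x : 'I_H * 'I_H | (x.1 < x.2)%N]| = #|[pred x : 'I_H * 'I_H | (x.2 < x.1)%N]|.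
  have inj : injective (fun x : 'I_H * 'I_H => (x.2, x.1)).
    by move=> [a b] [a' b'] /= [-> ->].
  rewrite -(fintype.card_image inj).
  apply: eq_card => -[a b]; apply/fintype.imageP/idP => [[[a' b'] /= h [-> ->]] //|h].
  by exists (b, a).
have h : (#|[pred x : 'I_H * 'I_H | (x.2 < x.1)%N]| +
          #|[pred x : 'I_H * 'I_H | (x.2 <= x.1)%N]| = H * H)%N.
  rewrite -swapE -[in RHS](card_ord H) -card_prod -(cardC [pred x : 'I_H * 'I_H | (x.1 < x.2)%N]).
  by congr addn; apply: eq_card => x; rewrite !inE -leqNgt.
have := card_lt_pairs H; rewrite -h.
by move: #|_| #|_| => u v; lia.
Qed.

(** The coefficients are the proportions of the pairs (a, b) with b < a and
    with b <= a among all H^2 pairs; both tend to 1/2. *)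
Lemma eq_half_of_sandwich {R : realType} (x y : R) : 0 <= y ->
  (forall H : nat, (0 < H)%N ->
     (H * H - H)%:R / 2 * (y / H%:R ^+ 2) <= x <= (H * H + H)%:R / 2 * (y / H%:R ^+ 2)) ->
  x = y / 2.
Proof.
move=> y0 h; apply/eqP; rewrite eq_sym -subr_eq0 -normr_eq0 eq_le normr_ge0 andbT.
apply/ler_addgt0Pr => e e0; rewrite add0r.
have [H hH] : exists H : nat, y / e < H.+1%:R.
  exists (Num.truncn (y / e)); by rewrite truncnS_gt.
have HR : 0 < H.+1%:R :> R by [].
have := h H.+1 isT; rewrite natrB ?leq_pmulr // natrD natrM.
have -> : (H.+1%:R * H.+1%:R - H.+1%:R) / 2 * (y / H.+1%:R ^+ 2) = y / 2 - y / (2 * H.+1%:R) :> R.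
  by field; rewrite gt_eqF.
have -> : (H.+1%:R * H.+1%:R + H.+1%:R) / 2 * (y / H.+1%:R ^+ 2) = y / 2 + y / (2 * H.+1%:R) :> R.
  by field; rewrite gt_eqF.
have : y / (2 * H.+1%:R) <= e.
  rewrite ler_pdivrMr ?mulr_gt0 //; rewrite ltr_pdivrMr // in hH.
  by apply: le_trans (ltW hH) _; nra.
by move: (y / (2 * _)) => z ze /andP[h1 h2]; rewrite ler_norml; apply/andP; split; lra.
Qed.

Section GapEvent.
Context {R : realType} {d : measure_display} {T : measurableType d}.
Variables (P : probability T R) (lambda : R) (Pi : T -> {mset R}%mset).
Hypothesis lambda_gt0 : 0 < lambda.
Hypothesis hPi : homogeneous_poisson_process P lambda Pi.
Variables (n l k : nat) (w : R).
Hypotheses (l_gt0 : (0 < l)%N) (l_lt_n : (l < n)%N) (wE : w = l%:R / n%:R).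
Hypothesis k_ge2 : (2 <= k)%N.

Let eps : R := lambda / n%:R.

Let n_pos : (0 < n)%N.
Proof. exact: leq_trans l_lt_n. Qed.
Let k_gt0 : (0 < k)%N.
Proof. exact: ltnW. Qed.
Let w_le1 : w <= 1.
Proof. exact: (w_le1 l_gt0 l_lt_n wE). Qed.
Let eps_ge0 : 0 <= eps.
Proof. by rewrite divr_ge0 ?ler0n // ltW. Qed.
Let supp o x : x \in Pi o -> 0 < x <= 1.
Proof. exact: (hpp_support hPi). Qed.

(** A window can be moved slightly to the right without losing points, so
    rational starts suffice, except for the last window, which begins at
    1 - w and cannot be moved. *)
Lemma measurable_scan_ge : measurable [set o | (k <= scan w (Pi o))%N].
Proof.
pose F (q : rat) : set T := if 0 <= (ratr q : R) <= 1 - w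
  then [set o | (k <= npts_oc (Pi o) (ratr q) (ratr q + w))%N] else set0.
rewrite (_ : [set o | _] = [set o | (k <= npts_oc (Pi o) (1 - w) (1 - w + w))%N]
                             `|` \bigcup_q F q).
  apply: measurableU.
    by apply: (measurable_npts_oc hPi [set j | (k <= j)%N]);
      rewrite ?subr_ge0 // subrK.
  apply: bigcupT_measurable_rat => q; rewrite /F; case: ifP => // /andP[q0 q1].
  apply: (measurable_npts_oc hPi [set j | (k <= j)%N]) => //.
  by rewrite -lerBrDr.
apply/seteqP; split => o /=; last first.
  move=> [h|[q _]].
    by apply: leq_trans h _; apply: npts_le_scan; rewrite subr_ge0 w_le1 lexx.
  rewrite /F; case: ifP => // q01 h; exact: leq_trans h (npts_le_scan _ q01).
have [t /andP[t0 t1] <-] := scan_attained (Pi o) w_le1 => kt.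
move: t1; rewrite le_eqVlt => /predU1P[t1|t1]; first by left; rewrite -t1.
right; have [u /andP[tu u1] gap] := gap_above (Pi o) t1.
have [q] := rat_in_itvoo tu; rewrite in_itv /= => /andP[tq qu].
exists q => //; rewrite /F ifT.
  apply: leq_trans kt _; apply: npts_le_in => x xA /andP[tx xt].
  rewrite (lt_trans qu (gap _ xA tx)) /=; apply: le_trans xt _.
  by rewrite lerD2r ltW.
by rewrite (ltW (le_lt_trans t0 tq)) ltW // (lt_trans qu u1).
Qed.

Lemma measurable_support_pred (Q : seq bool -> bool) :
  measurable [set o | Q (occupied_cells n (cell_count n (Pi o)))].
Proof.
rewrite (_ : [set o | _] = [set o | exists2 S, S \in map (@tval n bool) [seq x <- enum {: n.-tuple bool} | Q (tval x)]
    & (\bigcap_r [set o | [set j | (j != 0%N) = nth false S r] (cell_count n (Pi o) r)]) o]).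
  apply: measurable_exists_seq => S; apply: bigcapT_measurable => r.
  exact: (measurable_cell_count hPi).
have nthE o r := nth_occupied_cells (fun r => cell_count_beyond hPi n_pos o (r := r)) r.
apply/seteqP; split => o /=.
  move=> Qo; exists (occupied_cells n (cell_count n (Pi o))) => [|r _ /=]; last by rewrite nthE.
  apply/mapP; exists (tcast (size_occupied_cells n (cell_count n (Pi o))) (in_tuple _)).
    by rewrite mem_filter val_tcast Qo mem_enum.
  by rewrite val_tcast.
move=> [U /mapP[S]]; rewrite mem_filter => /andP[QS _] -> h.
rewrite (_ : occupied_cells n _ = S) //; apply: (@eq_from_nth _ false); first by rewrite size_occupied_cells size_tuple.
by move=> r _; rewrite nthE; apply: (h r I).
Qed.

Lemma measurable_discrete_scan_lt : measurable [set o | (discrete_scan n l (Pi o) < k)%N].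
Proof.
rewrite (_ : [set o | _] =
   [set o | windows_below n l k (conf (occupied_cells n (cell_count n (Pi o))))]).
  exact: (measurable_support_pred (fun S => windows_below n l k (conf S))).
have e o : (discrete_scan n l (Pi o) < k)%N =
    windows_below n l k (conf (occupied_cells n (cell_count n (Pi o)))).
  rewrite (discrete_scan_ltE (Pi o) l_gt0 l_lt_n) //; apply: eq_windows_below => r.
  by rewrite /conf nth_occupied_cells // => j; apply: (cell_count_beyond hPi).
by apply/seteqP; split => o /=; rewrite e.
Qed.

Definition gap_event : set T :=
  [set o | (k <= scan w (Pi o))%N && (discrete_scan n l (Pi o) < k)%N].

Lemma measurable_gap_event : measurable gap_event.
Proof.
rewrite (_ : gap_event = [set o | (k <= scan w (Pi o))%N] `&`
   [set o | (discrete_scan n l (Pi o) < k)%N]).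
  by apply: measurableI; [exact: measurable_scan_ge | exact: measurable_discrete_scan_lt].
by apply/seteqP; split => o; [move/andP | move=> h; apply/andP].
Qed.

Section OneConfiguration.
Variables (S : seq bool) (i : nat).
Hypotheses (S_size : size S = n) (S_sparse : sparse l S) (Si : nth false S i).

Let conf_ge r : (n <= r)%N -> conf S r = 0%N.
Proof. by move=> nr; rewrite /conf nth_default // S_size. Qed.

Let i_lt_n : (i < n)%N.
Proof. by rewrite -S_size occupied_lt_size. Qed.

(** The factor eps / 2 is the ratio of the Poisson masses at 2 and 1. *)
Lemma prob_gap_doubled :
  prob P (gap_event `&` count_event Pi n (add_at (conf S) i)) =
  eps / 2 * (doubling_raises n l k S i)%:R * prob P (count_event Pi n (conf S)).
Proof.
have cE : conf S i = 1%N by rewrite /conf Si.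
have e := prob_count_event_add lambda_gt0 hPi n_pos conf_ge i_lt_n.
have gE o : count_event Pi n (add_at (conf S) i) o ->
    gap_event o = doubling_raises n l k S i.
  move=> co; rewrite /gap_event /=.
  by rewrite (doubled_cellE l_gt0 l_lt_n wE k_ge2 (@supp o) S_sparse Si co).
case: (doubling_raises n l k S i) gE => gE; last first.
  rewrite mulr0 mul0r (_ : _ `&` _ = set0) ?/prob ?measure0 //.
  by apply/seteqP; split => o // [+ /gE h]; rewrite h.
rewrite (_ : _ `&` _ = count_event Pi n (add_at (conf S) i)).
  by rewrite e cE mulr1.
by apply/seteqP; split => o /= => [[]//|co]; split => //; rewrite (gE o co).
Qed.

Hypothesis il_lt_n : (i + l < n)%N.

(** The factor eps is the ratio of the Poisson masses at 1 and 0 in the cell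
    i + l. The factor 1/2 is the probability that the two points are less than
    w apart: it lies between the probabilities that the part of the first
    point comes after, and not before, the part of the second one, for every
    number H of parts. *)
Lemma prob_gap_partner :
  prob P (gap_event `&` count_event Pi n (add_at (conf S) (i + l))) =
  eps / 2 * (partner_tight n l k S i)%:R * prob P (count_event Pi n (conf S)).
Proof.
have [Sil Sill] := sparseP _ _ S_sparse _ Si.
pose c := add_at (conf S) (i + l).
have il : i <> (i + l)%N by clear - l_gt0; lia.
have ci : c i = 1%N by rewrite /c /add_at /conf Si (introF eqP il).
have cil : c (i + l)%N = 1%N by rewrite /c /add_at /conf Sil eqxx.
have c_ge r : (n <= r)%N -> c r = 0%N.
  by move=> nr; rewrite /c /add_at conf_ge // gtn_eqF // (leq_trans il_lt_n).
have e : prob P (count_event Pi n c) = eps * prob P (count_event Pi n (conf S)).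
  rewrite (prob_count_event_add lambda_gt0 hPi n_pos conf_ge il_lt_n).
  by rewrite /conf Sil divr1.
pose X H (x : 'I_H * 'I_H) := count_event Pi n c `&` fine_pair_event Pi n H i (i + l) x.1 x.2.
have prX H x : prob P (X H x) = prob P (count_event Pi n c) / H%:R ^+ 2.
  exact: (prob_fine_pair lambda_gt0 hPi n_pos c_ge i_lt_n il_lt_n il ci cil).
have mX H x : measurable (X H x).
  by apply: measurableI; [exact: (measurable_count_event hPi) |
    exact: (measurable_fine_pair_event hPi)].
have mG : measurable (gap_event `&` count_event Pi n c).
  by apply: measurableI; [exact: measurable_gap_event | exact: (measurable_count_event hPi)].
have sumX H (Q : pred ('I_H * 'I_H)) : \sum_(x <- enum Q) prob P (X H x) =
    #|Q|%:R * (prob P (count_event Pi n c) / H%:R ^+ 2).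
  rewrite (eq_bigr (fun _ => prob P (count_event Pi n c) / H%:R ^+ 2)) => [|x _]; last exact: prX.
  by rewrite big_enum /= sumr_const mulr_natl.
have [tight|loose] := boolP (partner_tight n l k S i); last first.
  rewrite mulr0 mul0r (_ : _ `&` _ = set0) ?/prob ?measure0 //.
  apply/seteqP; split => o // [/andP[kA kD] co].
  have [] := partner_crossing_of_scan l_gt0 l_lt_n wE k_ge2 (@supp o) S_sparse Si il_lt_n co
    (H := 1%N) isT kA kD.
  by move=> h; rewrite h in loose.
rewrite mulr1 (mulrAC eps) -e; apply: eq_half_of_sandwich; first exact: prob_ge0.
move=> H H0; apply/andP; split.
- have -> : (H * H - H)%:R / 2 = #|[pred x : 'I_H * 'I_H | (x.2 < x.1)%N]|%:R :> R.
    by rewrite -card_lt_pairs addnK -muln2 natrM mulfK.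
  rewrite -sumX; apply: prob_sum_le => //; first exact: enum_uniq.
    move=> x; rewrite mem_enum inE => x21 o [co [h1 h2]]; split => //.
    rewrite /gap_event /=.
    apply: (scan_of_partner_crossing l_gt0 l_lt_n wE k_ge2 S_sparse Si il_lt_n co (H := H) (a := x.1) (b := x.2)) => //.
    - by rewrite x21 ltn_ord.
    - by rewrite h1.
    - by rewrite h2.
  move=> [a b] [a' b'] o _ _ [co [h1 h2]] [_ [h3 h4]].
  congr pair; apply: ord_inj.
    by apply: (fine_cell_unique n_pos (ltn_ord a) (ltn_ord a') _ h1 h3); rewrite co.
  by apply: (fine_cell_unique n_pos (ltn_ord b) (ltn_ord b') _ h2 h4); rewrite co.
- have -> : (H * H + H)%:R / 2 = #|[pred x : 'I_H * 'I_H | (x.2 <= x.1)%N]|%:R :> R.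
    by rewrite -card_le_pairs -muln2 natrM mulfK.
  rewrite -sumX; apply: prob_le_sum => //.
  move=> o [/andP[kA kD] co].
  have [_ [a [b [/andP[ba aH] ha hb]]]] :=
    partner_crossing_of_scan l_gt0 l_lt_n wE k_ge2 (@supp o) S_sparse Si il_lt_n co H0 kA kD.
  have bH := leq_ltn_trans ba aH.
  have le1 j f : (f < H)%N -> cell_count n (Pi o) j = 1%N ->
      (0 < cell_count (n * H) (Pi o) (j * H + f))%N ->
      cell_count (n * H) (Pi o) (j * H + f) = 1%N.
    move=> fH cj h; apply/eqP; rewrite eqn_leq h andbT -cj.
    apply: npts_le_in => x _ xf.
    have := fine_cell_sub (R := R) n_pos fH (t := x) (i := j).
    by rewrite /cell /= !in_itv /=; apply.
  exists (Ordinal aH, Ordinal bH); first by rewrite mem_enum.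
  by split => //; split; apply: le1 => //; rewrite co.
Qed.
End OneConfiguration.
End GapEvent.

(** * Summation over the configurations *)

Section IntegralBounds.
Context {R : realType} {d : measure_display} {T : measurableType d}.
Variable P : probability T R.

(** The integral of a nonnegative function is the supremum of the integrals of
    the simple functions below it, and this is monotone for arbitrary
    functions. *)
Lemma ge0_integral_mono (f g : T -> \bar R) :
  (forall x, (0 <= f x)%E) -> (forall x, (f x <= g x)%E) ->
  (\int[P]_x f x <= \int[P]_x g x)%E.
Proof.
move=> f0 fg; have g0 x : (0 <= g x)%E by apply: le_trans (fg x).
rewrite !ge0_integralTE //; apply: ereal_sup_le => _ [h hf <-]; exists h => //= x.
exact: le_trans (hf x) (fg x).
Qed.

Lemma integral_sum_indic (I : Type) (L : seq I) (a : I -> R) (E : I -> set T) :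
  (forall i, 0 <= a i) -> (forall i, measurable (E i)) ->
  (\int[P]_o (\sum_(i <- L) a i * \1_(E i) o)%:E)%E =
  (\sum_(i <- L) a i * prob P (E i))%:E.
Proof.
move=> a0 mE.
have mI i : measurable_fun [set: T] (EFin \o (\1_(E i) : T -> R)).
  by apply/measurable_EFinP; apply: measurable_indic.
rewrite (eq_integral (fun o => \sum_(i <- L) ((a i)%:E * (\1_(E i) o)%:E))%E); last first.
  by move=> o _; rewrite -sumEFin; apply: eq_bigr => i _; rewrite EFinM.
rewrite ge0_integral_sum //.
- rewrite -sumEFin; apply: eq_bigr => i _.
  rewrite ge0_integralZl_EFin //; last exact: mI.
  by rewrite integral_indic // setIT EFinM; congr (_ * _)%E; apply: probE.
- by move=> i; apply: measurable_funeM; apply: mI.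
- by move=> i o _; rewrite -EFinM lee_fin mulr_ge0.
Qed.
End IntegralBounds.

Section Bounds.
Context {R : realType}.
Variables (n l k : nat) (w : R) (A : {mset R}%mset).
Hypotheses (l_gt0 : (0 < l)%N) (l_lt_n : (l < n)%N) (wE : w = l%:R / n%:R).
Hypothesis supp : forall x, x \in A -> 0 < x <= 1.

(** Each cell of the grid lies in a window of whole cells. *)
Lemma size_le_scan : (size A <= n * scan w A)%N.
Proof.
have n_pos : (0 < n)%N by apply: leq_trans l_lt_n.
have -> : size A = (\sum_(0 <= r < n) cell_count n A r)%N.
  rewrite -npts_grid // (grid_one n_pos) mul0r npts_itvE; apply/esym/eqP.
  by rewrite -all_count; apply/allP => x /supp.
rewrite big_mkord; apply: leq_trans (_ : (\sum_(r < n) scan w A <= _)%N).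
  apply: leq_sum => r _.
  have [rn|nr] := leqP r (n - l).
    apply: leq_trans (window_sum_le_scan A l_gt0 l_lt_n wE rn).
    by rewrite window_sum_recl // leq_addr.
  apply: leq_trans (window_sum_le_scan A l_gt0 l_lt_n wE (leqnn (n - l))).
  rewrite /window_sum subnK ?(ltnW l_lt_n) //.
  by rewrite (big_cat_nat (n := r)) ?(ltnW nr) ?(ltnW (ltn_ord r)) //= [X in (_ + X)%N]big_ltn // addnCA leq_addr.
by rewrite sum_nat_const card_ord.
Qed.

(** Both functionals vanish unless the scan is below k, and each is at most the
    number of points. *)
Lemma nu_sum_le : (nu w k A + nu_tilde w k A <= 2 * n * k)%N.
Proof.
have sum_le (Q : pred R) (b : R -> bool) : (forall x, b x -> (scan w A < k)%N) ->
    (\sum_(x <- A | Q x) b x <= n * k)%N.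
  move=> bk; have [sk|ks] := ltnP (scan w A) k; last first.
    rewrite big1 // => x _; case: (boolP (b x)) => // /bk.
    by rewrite ltnNge ks.
  apply: leq_trans (_ : (\sum_(x <- A | Q x) 1 <= _)%N).
    by apply: leq_sum => x _; case: (b x).
  rewrite sum1_count; apply: leq_trans (count_size _ _) _.
  by apply: leq_trans size_le_scan _; rewrite leq_mul2l ltnW ?orbT.
rewrite -mulnA mul2n -addnn; apply: leq_add.
  by apply: sum_le => x /and3P[].
by apply: sum_le => x /andP[].
Qed.
End Bounds.

Section Expansion.
Context {R : realType} {d : measure_display} {T : measurableType d}.
Variables (P : probability T R) (lambda : R) (Pi : T -> {mset R}%mset).
Hypothesis lambda_gt0 : 0 < lambda.
Hypothesis hPi : homogeneous_poisson_process P lambda Pi.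
Variables (n l k : nat) (w : R).
Hypotheses (l_gt0 : (0 < l)%N) (l_lt_n : (l < n)%N) (wE : w = l%:R / n%:R).
Hypothesis k_ge2 : (2 <= k)%N.

Let eps : R := lambda / n%:R.
Local Notation count_event := (count_event Pi n).
Local Notation gap := (gap_event Pi n l k w).

Let n_pos : (0 < n)%N.
Proof. exact: leq_trans l_lt_n. Qed.
Let k_gt0 : (0 < k)%N.
Proof. exact: ltnW. Qed.
Let eps_ge0 : 0 <= eps.
Proof. by rewrite divr_ge0 ?ler0n // ltW. Qed.
Let supp o x : x \in Pi o -> 0 < x <= 1.
Proof. exact: (hpp_support hPi). Qed.
Let mgap : measurable gap.
Proof. exact: (measurable_gap_event hPi l_gt0 l_lt_n wE k_ge2). Qed.

Lemma measurable_has_covers (L : seq (seq nat)) :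
  measurable [set o | has (covers^~ (cell_count n (Pi o))) L].
Proof.
rewrite (_ : [set o | _] = [set o | exists2 s, s \in L & covers s (cell_count n (Pi o))]).
  by apply: measurable_exists_seq => s; apply: (measurable_covers hPi).
by apply/seteqP; split => o /=; [move/hasP | move=> h; apply/hasP].
Qed.

Lemma prob_has_covers_le (L : seq (seq nat)) :
  prob P [set o | has (covers^~ (cell_count n (Pi o))) L] <= \sum_(s <- L) eps ^+ size s.
Proof.
apply: (@le_trans _ _ (\sum_(s <- L) prob P [set o | covers s (cell_count n (Pi o))])).
  apply: prob_le_sum => [|s|o /hasP //]; first exact: measurable_has_covers.
  exact: (measurable_covers hPi).
by apply: ler_sum => s _; apply: (prob_covers lambda_gt0 hPi n_pos).
Qed.

Lemma sum_exp_const_size (L : seq (seq nat)) (j : nat) :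
  {in L, forall s, size s = j} -> \sum_(s <- L) eps ^+ size s = (size L)%:R * eps ^+ j.
Proof.
move=> Lj; rewrite (eq_big_seq (fun _ => eps ^+ j)); last by move=> s /Lj ->.
by rewrite big_const_seq iter_addr_0 count_predT mulr_natl.
Qed.

Let size_close_pair s : s \in close_pairs n l -> size s = 2%N.
Proof. by move=> /allpairsP[x [_ _ ->]]. Qed.

Lemma prob_has_close_pair_le :
  prob P [set o | has_close_pair n l (cell_count n (Pi o))] <= 3 * n%:R * eps ^+ 2.
Proof.
apply: le_trans (prob_has_covers_le _) _; rewrite (sum_exp_const_size size_close_pair).
by rewrite size_allpairs size_iota natrM [n%:R * _]mulrC.
Qed.

Lemma prob_clumped_le :
  prob P [set o | clumped n l (cell_count n (Pi o))] <=
  25 * n%:R * eps ^+ 3 + 9 * n%:R ^+ 2 * eps ^+ 4.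
Proof.
apply: le_trans (prob_has_covers_le _) _; rewrite big_cat /= lerD //.
  rewrite (@sum_exp_const_size _ 3); last by move=> s /allpairsP[x [_ _ ->]].
  by rewrite !size_allpairs size_iota natrM [n%:R * _]mulrC.
rewrite (@sum_exp_const_size _ 4); last first.
  by move=> s /allpairsP[x [h1 h2 ->]]; rewrite size_cat !size_close_pair.
rewrite !size_allpairs size_iota !natrM ler_wpM2r ?exprn_ge0 //.
by rewrite expr2 /=; lra.
Qed.

(* a sparse configuration S, the cell i, and whether the point is added to the
   cell i + l (true) or to the cell i (false) *)
Local Notation index := (n.-tuple bool * 'I_n * bool)%type.

Definition admissible (x : index) : bool :=
  [&& sparse l x.1.1, nth false x.1.1 x.1.2 & (x.1.2 + x.2 * l < n)%N].

Definition gap_config (x : index) : nat -> nat := add_at (conf x.1.1) (x.1.2 + x.2 * l).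

(** The value of nu + nu_tilde on the configuration S. *)
Definition config_weight (S : seq bool) : nat :=
  (\sum_(i < n) conf S i * partner_tight n l k S i +
   \sum_(i < n) conf S i * doubling_raises n l k S i)%N.

Definition sparse_weight (S : n.-tuple bool) : R :=
  if sparse l S then (config_weight S)%:R else 0.

(** The expectation of nu + nu_tilde over the sparse configurations. *)
Definition main_term : R := \sum_(S : n.-tuple bool) sparse_weight S * prob P (count_event (conf S)).

Lemma prob_gap_config (x : index) : admissible x ->
  prob P (gap `&` count_event (gap_config x)) =
  eps / 2 * ((if x.2 then partner_tight n l k x.1.1 x.1.2
              else doubling_raises n l k x.1.1 x.1.2)%:R * prob P (count_event (conf x.1.1))).
Proof.
case: x => [[S i] []]; rewrite /gap_config /= => /and3P[/= spS Si iln]; rewrite mulrA.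
  rewrite mul1n in iln *.
  exact: (prob_gap_partner lambda_gt0 hPi l_gt0 l_lt_n wE k_ge2 (size_tuple S) spS Si iln).
rewrite mul0n addn0.
exact: (prob_gap_doubled lambda_gt0 hPi l_gt0 l_lt_n wE k_ge2 (size_tuple S) spS Si).
Qed.

Lemma sum_gap_config :
  \sum_(x <- enum admissible) prob P (gap `&` count_event (gap_config x)) = eps / 2 * main_term.
Proof.
rewrite big_enum /= (eq_bigr _ prob_gap_config) -mulr_sumr; congr (_ * _).
rewrite big_mkcond /= -(pair_bigA _ (fun Si b => if admissible (Si, b) then
   (if b then partner_tight n l k Si.1 Si.2
              else doubling_raises n l k Si.1 Si.2)%:R * prob P (count_event (conf Si.1)) else 0)) /=.
rewrite -(pair_bigA _ (fun S i => \sum_(b : bool) if admissible ((S, i), b) then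
   (if b then partner_tight n l k S i
              else doubling_raises n l k S i)%:R * prob P (count_event (conf S)) else 0)) /=.
apply: eq_bigr => S _; rewrite /sparse_weight; case: ifP => spS; last first.
  by rewrite mul0r big1 // => i _; rewrite big1 // => b _; rewrite /admissible /= spS.
rewrite natrD !natr_sum -big_split /= mulr_suml; apply: eq_bigr => i _.
rewrite big_bool /admissible /= spS /= mul1n mul0n addn0 ltn_ord andbT /conf.
case: (nth false S i); rewrite ?mul0n ?mul1n ?addr0 ?mul0r //= mulrDl; congr (_ + _).
by case: ifP => // il; rewrite /partner_tight il mul0r.
Qed.

Lemma gap_config_inj (x y : index) : admissible x -> admissible y ->
  gap_config x =1 gap_config y -> x = y.
Proof.
case: x y => [[S i] b] [[S' i'] b'] /and3P[/= spS Si _] /and3P[/= spS' Si' _] e.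
have [SS ii bb] := add_at_inj l_gt0 (size_tuple S) (size_tuple S') spS spS' Si Si' e.
by move: bb => /= ->; rewrite (ord_inj ii) (val_inj SS).
Qed.

(** The configurations with one coincidence are disjoint parts of the sample
    space, by [gap_config_inj]. *)
Lemma main_term_le_gap : eps / 2 * main_term <= prob P gap.
Proof.
rewrite -sum_gap_config; apply: prob_sum_le => //; first exact: enum_uniq.
  by move=> x; apply: measurableI => //; apply: (measurable_count_event hPi).
move=> x y o; rewrite !mem_enum => ax ay [_ cx] [_ cy]; apply: gap_config_inj => // r.
by rewrite -cx -cy.
Qed.

Lemma gap_le_main_term :
  prob P gap <= eps / 2 * main_term + (25 * n%:R * eps ^+ 3 + 9 * n%:R ^+ 2 * eps ^+ 4).
Proof.
pose F x := gap `&` count_event (gap_config x).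
have mF x : measurable (F x) by apply: measurableI => //; apply: (measurable_count_event hPi).
pose U := [set o | exists2 x, x \in enum admissible & F x o].
have mU : measurable U by apply: measurable_exists_seq.
have mC := measurable_has_covers (clumps n l).
apply: le_trans (_ : prob P (U `|` [set o | clumped n l (cell_count n (Pi o))]) <= _).
  apply: prob_le => //; first exact: measurableU.
  move=> o go; have /andP[kA kD] := go.
  have [?|nc] := boolP (clumped n l (cell_count n (Pi o))); [by right | left].
  have [S [i [b [sS spS Si iln cS]]]] :=
    scan_gap_configuration l_gt0 l_lt_n wE k_gt0 (@supp o) kA kD nc.
  have i_n : (i < n)%N by rewrite -sS occupied_lt_size.
  pose S' : n.-tuple bool := tcast sS (in_tuple S).
  have S'E : S' = S :> seq bool by rewrite val_tcast.
  exists (S', Ordinal i_n, b); last by split => // r; rewrite /gap_config /= S'E.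
  by rewrite mem_enum; apply/and3P; rewrite /= S'E; split.
apply: le_trans (prob_union_le _ _ _) _ => //; apply: lerD; last exact: prob_clumped_le.
by rewrite -sum_gap_config; apply: prob_le_sum.
Qed.

Let no_atom : set T := [set o | npts (Pi o) [set 1 - w] = 0%N].

Let w_in : 0 < 1 - w <= 1.
Proof.
have w1 : w < 1 by rewrite wE -[ltRHS](grid_one n_pos) lt_grid.
by rewrite subr_gt0 w1 lerBlDr lerDl wE divr_ge0.
Qed.

Let mno_atom : measurable no_atom.
Proof.
apply: (measurable_npts hPi [set 0%N]) => // x ->.
by rewrite /= in_itv.
Qed.

Let prob_atom : prob P (~` no_atom) = 0.
Proof.
have h : P no_atom = 1%E.
  have s01 : [set 1 - w] `<=` `]0, 1] by move=> x ->; rewrite /= in_itv.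
  rewrite (hpp_law hPi (measurable_set1 _) s01 [set 0%N]) lebesgue_measure_set1 mulr0.
  by rewrite poisson_prob_set1 // -[in RHS](poisson_mass00 lambda) mulr0.
rewrite /prob probability_setC // h.
by rewrite subee.
Qed.

Let prob_no_atom (E : set T) : measurable E -> prob P (E `&` no_atom) = prob P E.
Proof.
move=> mE; apply/eqP; rewrite eq_le prob_le //=; last exact: measurableI.
apply: le_trans (_ : prob P ((E `&` no_atom) `|` ~` no_atom) <= _).
  apply: prob_le => //; first by apply: measurableU; [exact: measurableI | exact: measurableC].
  by move=> o Eo; have [h|h] := pselect (no_atom o); [left | right].
apply: le_trans (prob_union_le _ _ _) _; [exact: measurableI | exact: measurableC |].
by rewrite prob_atom addr0.
Qed.

Let no_atom_notin o : no_atom o -> 1 - w \notin Pi o.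
Proof.
move=> h; apply/negP => win; move: h; rewrite /no_atom /npts /= => /eqP.
rewrite -leqn0 leqNgt -has_count => /hasP[]; exists (1 - w) => //.
exact/mem_set.
Qed.

Local Notation V o := (nu w k (Pi o) + nu_tilde w k (Pi o))%N.

Lemma functionals_on_config (S : n.-tuple bool) (o : T) : sparse l S ->
  count_event (conf S) o -> no_atom o -> V o = config_weight S.
Proof.
move=> spS cS /no_atom_notin wA.
by rewrite (nu_confE l_gt0 l_lt_n wE k_ge2 (@supp o) spS cS wA)
  (nu_tilde_confE l_gt0 l_lt_n wE k_ge2 (@supp o) spS cS).
Qed.

Let E (S : n.-tuple bool) := count_event (conf S) `&` no_atom.

Let mE S : measurable (E S).
Proof. by apply: measurableI => //; apply: (measurable_count_event hPi). Qed.

Let sparse_weight_ge0 S : 0 <= sparse_weight S.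
Proof. by rewrite /sparse_weight; case: ifP. Qed.

Let main_termE : \sum_(S : n.-tuple bool) sparse_weight S * prob P (E S) = main_term.
Proof. by apply: eq_bigr => S _; rewrite prob_no_atom //; apply: (measurable_count_event hPi). Qed.

Lemma main_term_le_expectation : (main_term%:E <= \int[P]_o ((V o)%:R : R)%:E)%E.
Proof.
rewrite -main_termE -integral_sum_indic //.
apply: ge0_integral_mono => o; rewrite lee_fin.
  by apply: sumr_ge0 => S _; rewrite mulr_ge0.
have [[S [spS [cS No]]]|none] := pselect (exists S : n.-tuple bool, sparse l S /\ E S o).
  rewrite (bigD1 S) //= big1 ?addr0.
    rewrite /sparse_weight spS indicE mem_set // mulr1.
    by rewrite -(functionals_on_config spS cS No).
  move=> S' S'S; rewrite indicE memNset ?mulr0 // => -[cS' _].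
  move/eqP: S'S; apply; apply: val_inj; apply: (@eq_from_nth _ false); rewrite ?size_tuple // => r _.
  by have := cS r; rewrite (cS' r) /conf; case: nth; case: nth.
rewrite big1 // => S _; rewrite /sparse_weight; case: ifP => spS; last by rewrite mul0r.
by rewrite indicE memNset ?mulr0 // => ES; apply: none; exists S.
Qed.

Lemma expectation_le_main_term (C : nat) : (forall o, V o <= C)%N ->
  (\int[P]_o ((V o)%:R : R)%:E <= (main_term + C%:R * (3 * n%:R * eps ^+ 2))%:E)%E.
Proof.
move=> VC.
pose close := [set o | has_close_pair n l (cell_count n (Pi o))].
have mclose : measurable close by apply: measurable_has_covers.
pose bad := close `|` ~` no_atom.
have mbad : measurable bad by apply: measurableU => //; apply: measurableC.
(* None stands for the bad event, on which the bound C has to be used *)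
pose a (x : option (n.-tuple bool)) : R := if x is Some s then sparse_weight s else C%:R.
pose F x := if x is Some s then E s else bad.
apply: (@le_trans _ _ (\int[P]_o (\sum_(x <- None :: map Some (index_enum (n.-tuple bool)))
   a x * \1_(F x) o)%:E)%E).
  apply: ge0_integral_mono => o; rewrite lee_fin // big_cons big_map /=.
  have sum_ge0 : 0 <= \sum_(S : n.-tuple bool) sparse_weight S * \1_(E S) o.
    by apply: sumr_ge0 => S _; rewrite mulr_ge0.
  have [bo|nbo] := pselect (bad o).
    by rewrite indicE mem_set // mulr1 -[leLHS]addr0 lerD // ler_nat.
  rewrite indicE memNset // mulr0 add0r.
  have alone : ~~ has_close_pair n l (cell_count n (Pi o)).
    by apply/negP => h; apply: nbo; left.
  have No : no_atom o by apply: contrapT => h; apply: nbo; right.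
  have c_ge j : (n <= j)%N -> cell_count n (Pi o) j = 0%N by apply: (cell_count_beyond hPi).
  pose S : n.-tuple bool := tcast (size_occupied_cells n (cell_count n (Pi o))) (in_tuple _).
  have SE : S = occupied_cells n (cell_count n (Pi o)) :> seq bool by rewrite val_tcast.
  have spS : sparse l S by rewrite SE sparse_occupied_cells.
  have cS : count_event (conf S) o.
    by move=> r; rewrite SE (conf_occupied_cells c_ge alone).
  rewrite (bigD1 S) //= /sparse_weight spS indicE mem_set // mulr1.
  rewrite -(functionals_on_config spS cS No) lerDl.
  by apply: sumr_ge0 => S' _; rewrite mulr_ge0 // -/(sparse_weight S').
rewrite integral_sum_indic; last 2 first.
- by case=> [S|] /=.
- by case=> [S|] /=.
rewrite lee_fin big_cons big_map /= main_termE addrC lerD2l ler_wpM2l //.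
apply: le_trans (prob_union_le _ _ _) _ => //; first exact: measurableC.
by rewrite prob_atom addr0; apply: prob_has_close_pair_le.
Qed.

(** The first two terms of the bound come from configurations with two
    coincidences, in the probability of the gap event. The third one comes from
    those with one or more, in the expectation. *)
Lemma gap_asymptotics (C : nat) (I : R) : (forall o, V o <= C)%N ->
  (\int[P]_o ((V o)%:R : R)%:E)%E = I%:E ->
  `|n%:R * prob P gap - lambda / 2 * I| <=
  (25 * lambda ^+ 3 + 9 * lambda ^+ 4 + 3 * C%:R * lambda ^+ 3) / n%:R.
Proof.
move=> VC VI.
have h1 := main_term_le_expectation; have h2 := expectation_le_main_term VC.
rewrite VI !lee_fin in h1 h2.
have h3 := main_term_le_gap; have h4 := gap_le_main_term.
have nR : 0 < n%:R :> R by rewrite ltr0n.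
have n0 : n%:R != 0 :> R by rewrite gt_eqF.
have e3 : n%:R * (25 * n%:R * eps ^+ 3 + 9 * n%:R ^+ 2 * eps ^+ 4) =
          (25 * lambda ^+ 3 + 9 * lambda ^+ 4) / n%:R by rewrite /eps; field.
have e2 : lambda / 2 * (C%:R * (3 * n%:R * eps ^+ 2)) = (3 / 2 * C%:R * lambda ^+ 3) / n%:R.
  by rewrite /eps; field.
have e1 : n%:R * (eps / 2 * main_term) = lambda / 2 * main_term by rewrite /eps; field.
have l3 : 0 <= C%:R * lambda ^+ 3 / n%:R.
  by rewrite divr_ge0 ?mulr_ge0 ?exprn_ge0 // ltW.
have l4 : 0 <= (25 * lambda ^+ 3 + 9 * lambda ^+ 4) / n%:R.
  by rewrite divr_ge0 ?addr_ge0 ?mulr_ge0 ?exprn_ge0 // ltW.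
have lam : 0 <= lambda / 2 by rewrite divr_ge0 // ltW.
have k1 := ler_wpM2l lam h1; have k2 := ler_wpM2l lam h2.
have k3 := ler_wpM2l (ltW nR) h3; have k4 := ler_wpM2l (ltW nR) h4.
rewrite mulrDr e2 in k2; rewrite e1 in k3; rewrite mulrDr e1 e3 in k4.
have -> : (25 * lambda ^+ 3 + 9 * lambda ^+ 4 + 3 * C%:R * lambda ^+ 3) / n%:R =
   (25 * lambda ^+ 3 + 9 * lambda ^+ 4) / n%:R + 3 * (C%:R * lambda ^+ 3 / n%:R) by field.
have k5 : 3 / 2 * C%:R * lambda ^+ 3 / n%:R = 3 / 2 * (C%:R * lambda ^+ 3 / n%:R) by field.
rewrite k5 in k2.
move: l3 l4 k1 k2 k3 k4.
move: (_ / n%:R) ((25 * _ + _) / _) => u v.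
by move=> *; rewrite ler_norml; apply/andP; split; lra.
Qed.

End Expansion.

(** * The limit *)

Lemma discrete_scan_lt_of_scan_lt {R : realType} (n l k : nat) (w : R) (A : {mset R}%mset) :
  (0 < l)%N -> (l < n)%N -> w = l%:R / n%:R -> (0 < k)%N ->
  (scan w A < k)%N -> (discrete_scan n l A < k)%N.
Proof.
move=> l0 ln wE k0 /(scan_lt_windows_below l0 ln wE) /windows_belowP h.
rewrite (discrete_scan_ltE A l0 ln) //; apply/windows_belowP => s /h.
by apply: leq_ltn_trans; apply: leq_sum => r _; case: (cell_count n A r).
Qed.

Lemma alpha_sub_discrete_alpha {R : realType} (d : measure_display)
    (T : measurableType d) (P : probability T R) (lambda w : R) (n l k : nat)
    (Pi : T -> {mset R}%mset) :
  homogeneous_poisson_process P lambda Pi ->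
  (0 < l)%N -> (l < n)%N -> w = l%:R / n%:R -> (2 <= k)%N ->
  (alpha P w k Pi - discrete_alpha P n l k Pi = (prob P (gap_event Pi n l k w))%:E)%E.
Proof.
move=> hPi l0 ln wE k2; have k0 : (0 < k)%N by apply: ltnW.
have mG := measurable_gap_event hPi l0 ln wE k2.
have mD : measurable [set o | (k <= discrete_scan n l (Pi o))%N].
  rewrite (_ : [set o | _] = ~` [set o | (discrete_scan n l (Pi o) < k)%N]).
    by apply: measurableC; apply: (measurable_discrete_scan_lt hPi l0 ln k2).
  apply/seteqP; split => o /=; first by rewrite leqNgt => /negP.
  by move=> /negP; rewrite -leqNgt.
have e : [set o | (k <= scan w (Pi o))%N] =
    gap_event Pi n l k w `|` [set o | (k <= discrete_scan n l (Pi o))%N].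
  apply/seteqP; split => o /=.
    move=> h; rewrite /gap_event /= h /=.
    by have [|] := ltnP (discrete_scan n l (Pi o)) k; [left | right].
  move=> [/andP[] //|]; apply: contraLR; rewrite -!ltnNge.
  exact: discrete_scan_lt_of_scan_lt.
rewrite /alpha /discrete_alpha e probE; last exact: measurableU.
rewrite [X in (_ - X)%E]probE // -EFinB prob_disjoint_union ?addrK //.
by apply/seteqP; split => o // -[/andP[_ h]] /=; rewrite leqNgt h.
Qed.

Theorem theorem2p1 (R : realType) (d : measure_display)
    (T : measurableType d) (P : probability T R)
    (lambda w : R) (p q k : nat) (Pi : T -> {mset R}%mset)
    (lambda_gt0 : 0 < lambda)
    (p_gt0 : (0 < p)%N) (q_gt0 : (0 < q)%N) (coprime_pq : coprime p q)
    (w_pq : w = p%:R / q%:R) (w01 : 0 < w < 1)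
    (k_ge2 : (2 <= k)%N)
    (poisson_Pi : homogeneous_poisson_process P lambda Pi) :
  ((m * q)%:R%:E *
      (alpha P w k Pi - discrete_alpha P (m * q) (m * p) k Pi))%E
    @[m --> \oo] -->
  ((lambda / 2)%:E *
    'E_P[fun o => (nu w k (Pi o) + nu_tilde w k (Pi o))%:R])%E.
Proof.
have pq : (p < q)%N.
  by have /andP[_] := w01; rewrite w_pq -[ltRHS](grid_one q_gt0) lt_grid.
pose V o := (nu w k (Pi o) + nu_tilde w k (Pi o))%N.
(* the grid of q cells gives a bound on the functionals that is free of m *)
pose C := (2 * q * k)%N.
have VC o : (V o <= C)%N.
  by apply: (nu_sum_le k p_gt0 pq w_pq) => x; apply: (hpp_support poisson_Pi).
have V_fin : (\int[P]_o ((V o)%:R : R)%:E)%E \is a fin_num.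
  rewrite ge0_fin_numE; last by apply: integral_ge0 => o _; rewrite lee_fin.
  apply: (@le_lt_trans _ _ (\int[P]_o (C%:R%:E))%E).
    by apply: ge0_integral_mono => o; rewrite lee_fin // ler_nat.
  rewrite integral_cst // -[X in (_ * X)%E]/(P [set: T]) [X in (_ * X)%E]probability_setT.
  by rewrite mule1 ltry.
rewrite unlock -(fineK V_fin) -EFinM.
set I := fine _.
pose x m : R := (m * q)%:R * prob P (gap_event Pi (m * q) (m * p) k w).
have xE : \forall m \near \oo, (x m)%:E = ((m * q)%:R%:E *
      (alpha P w k Pi - discrete_alpha P (m * q) (m * p) k Pi))%E.
  near=> m; have m0 : (0 < m)%N by near: m; exists 1%N.
  rewrite (alpha_sub_discrete_alpha poisson_Pi) ?muln_gt0 ?m0 ?ltn_pmul2l //.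
  by rewrite w_pq !natrM -mulf_div divff ?mul1r // pnatr_eq0 -lt0n.
apply: cvg_trans; first exact: near_eq_cvg xE.
apply: cvg_EFin; first exact: nearW.
pose K := 25 * lambda ^+ 3 + 9 * lambda ^+ 4 + 3 * C%:R * lambda ^+ 3.
have K_ge0 : 0 <= K by rewrite !addr_ge0 ?mulr_ge0 ?exprn_ge0 // ltW.
apply/cvgrPdist_le => e e_gt0; near=> m.
have m_gt0 : (0 < m)%N by near: m; exists 1%N.
have mR : 0 < m%:R :> R by rewrite ltr0n.
rewrite /= distrC.
have l_gt0 : (0 < m * p)%N by rewrite muln_gt0 m_gt0.
have l_lt_n : (m * p < m * q)%N by rewrite ltn_pmul2l.
have wE : w = (m * p)%:R / (m * q)%:R.
  by rewrite w_pq !natrM -mulf_div divff ?mul1r // pnatr_eq0 -lt0n.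
apply: le_trans (gap_asymptotics lambda_gt0 poisson_Pi l_gt0 l_lt_n wE k_ge2 VC (esym (fineK V_fin))) _.
rewrite -/K ler_pdivrMr ?ltr0n ?muln_gt0 ?m_gt0 //.
have Km : K / e <= m%:R by near: m; apply: nbhs_infty_ger.
rewrite ler_pdivrMr // mulrC in Km.
apply: le_trans Km _; rewrite ler_wpM2l ?(ltW e_gt0) // ler_nat.
by rewrite leq_pmulr.
Unshelve. all: by end_near.
Qed.
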